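(* (i) For $\mathcal{Q}\in\{\text{CQ},\text{rCQ}\}$, the following problem is undecidable: given a Horn-$\mathcal{ALC}$ KB $\mathcal{K}_1$, an $\mathcal{ALC}$ KB $\mathcal{K}_2$ and a signature $\Sigma$, decide whether $\mathcal{K}_1$ $\Sigma$-$\mathcal{Q}$ entails $\mathcal{K}_2$. (ii) For $\mathcal{Q}\in\{\text{CQ},\text{rCQ}\}$, the following problem is undecidable: given a Horn-$\mathcal{ALC}$ KB $\mathcal{K}_1$, an $\mathcal{ALC}$ KB $\mathcal{K}_2$ and a signature $\Sigma$, decide whether $\mathcal{K}_1$ and $\mathcal{K}_2$ are $\Sigma$-$\mathcal{Q}$ inseparable. (iii) Both (i) and (ii) remain undecidable when $\Sigma$ is required to be the full signature (all concept and role names).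
   Context: $\mathcal{ALC}$ concepts are built from concept names and $\top$ using $\neg$, $\sqcap$, $\exists R.C$; a TBox is a finite set of inclusions $C\sqsubseteq D$; a TBox is Horn-$\mathcal{ALC}$ if no $\neg C$ occurs negatively and no $\exists R.\neg C$ occurs positively. An ABox is a finite set of assertions $A(a)$, $R(a,b)$; a KB is $\mathcal{K}=(\mathcal{T},\mathcal{A})$ (Horn-$\mathcal{ALC}$ if $\mathcal{T}$ is), $\mathsf{ind}(\mathcal{K})$ its individuals; interpretations satisfy $a^{\mathcal{I}}=a$. A CQ $q(\vec x)=\exists\vec y\,\varphi$ is a conjunction of atoms $A(z)$, $R(z,z')$; it is rooted (rCQ) if every quantified variable is connected, in the undirected graph with edges $\{u,v\}$ for atoms $R(u,v)$, to some answer variable. $\mathcal{K}\models q(\vec a)$ means every model of $\mathcal{K}$ satisfies $q(\vec a)$. A $\Sigma$-query uses only concept/role names from $\Sigma$. For consistent KBs, $\mathcal{K}_1$ $\Sigma$-$\mathcal{Q}$ entails $\mathcal{K}_2$ if for every $\Sigma$-query $q(\vec x)$ in $\mathcal{Q}$ and tuple $\vec a$ from $\mathsf{ind}(\mathcal{K}_2)$, $\mathcal{K}_2\models q(\vec a)$ implies $\vec a\subseteq\mathsf{ind}(\mathcal{K}_1)$ and $\mathcal{K}_1\models q(\vec a)$; they are $\Sigma$-$\mathcal{Q}$ inseparable if each $\Sigma$-$\mathcal{Q}$ entails the other. *)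

(* Defs.v *)
From Stdlib Require List.
From mathcomp Require Import all_boot.

Set Implicit Arguments.
Unset Strict Implicit.
Unset Printing Implicit Defensive.

Inductive recfun : nat -> Type :=
| RZero n : recfun n
| RSucc : recfun 1
| RProj n (i : 'I_n) : recfun n
| RComp k n (f : recfun k) (g : 'I_k -> recfun n) : recfun n
| RPrim n (f : recfun n) (g : recfun n.+2) : recfun n.+1
| RMin n (f : recfun n.+1) : recfun n.

(* [graph f v r]: the partial function denoted by [f] is defined at the
   arguments [v], with value [r].
   - In [RPrim f g] the first argument is the recursion variable, and [g]
     receives the counter, the previous value and the parameters; [s] is the
     sequence of intermediate values.
   - [RMin f] is unbounded minimisation over the first argument of [f], all
     values of [f] below the minimum having to be defined and nonzero. *)
Fixpoint graph n (f : recfun n) : n.-tuple nat -> nat -> Prop :=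
  match f in recfun n return n.-tuple nat -> nat -> Prop with
  | RZero _ => fun _ r => r = 0
  | RSucc => fun v r => r = (thead v).+1
  | RProj _ i => fun v r => r = tnth v i
  | RComp k _ f g => fun v r =>
      exists2 w : k.-tuple nat,
        forall i, graph (g i) v (tnth w i) & graph f w r
  | RPrim _ f g => fun v r =>
      exists s : nat -> nat,
        [/\ graph f (behead_tuple v) (s 0),
            forall i, i < thead v ->
              graph g [tuple of i :: s i :: behead_tuple v] (s i.+1)
          & r = s (thead v)]
  | RMin _ f => fun v r =>
      graph f [tuple of r :: v] 0 /\
      forall i, i < r -> exists k, graph f [tuple of i :: v] k.+1
  end.

(* The decision problem with instances [x : T] such that [valid x], presented
   to the algorithm as the number [encode x], and with yes-instances those
   satisfying [P].  An algorithm is only required to terminate, with the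
   correct answer, on valid instances. *)
Definition decidable_problem (T : Type) (encode : T -> nat)
    (valid P : T -> Prop) : Prop :=
  exists f : recfun 1, forall x, valid x ->
    exists2 b : bool, graph f [tuple encode x] b & (b <-> P x).

Definition undecidable_problem (T : Type) (encode : T -> nat)
    (valid P : T -> Prop) : Prop :=
  ~ decidable_problem encode valid P.

Definition concept_name := nat.
Definition role_name := nat.
Definition individual := nat.
Definition variable := nat.

Inductive concept :=
| CName of concept_name
| CTop
| CNot of concept
| CAnd of concept & concept
| CEx of role_name & concept.

(* [(C, D)] is the inclusion of [C] in [D]; finite sets of inclusions and of
   assertions are given by lists. *)
Definition inclusion := (concept * concept)%type.
Definition tbox := seq inclusion.

Inductive assertion :=
| AConcept of concept_name & individual
| ARole of role_name & individual & individual.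

Definition abox := seq assertion.

Record kb := KB { kb_tbox : tbox; kb_abox : abox }.

Definition assertion_inds (al : assertion) : seq individual :=
  match al with
  | AConcept _ a => [:: a]
  | ARole _ a b => [:: a; b]
  end.

Definition ind (K : kb) : seq individual :=
  flatten [seq assertion_inds al | al <- kb_abox K].

(* [occurs p C D]: [C] has a positive ([p = true]) or negative ([p = false])
   occurrence in the concept [D]. *)
Inductive occurs : bool -> concept -> concept -> Prop :=
| occ_refl C : occurs true C C
| occ_not p C D : occurs p C D -> occurs (~~ p) C (CNot D)
| occ_andl p C D E : occurs p C D -> occurs p C (CAnd D E)
| occ_andr p C D E : occurs p C E -> occurs p C (CAnd D E)
| occ_ex p C R D : occurs p C D -> occurs p C (CEx R D).

(* The left-hand side of an inclusion is a negative position. *)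
Definition occurs_tbox (p : bool) (C : concept) (T : tbox) : Prop :=
  exists D E, List.In (D, E) T /\ (occurs (~~ p) C D \/ occurs p C E).

Definition horn_tbox (T : tbox) : Prop :=
  (forall C, ~ occurs_tbox false (CNot C) T) /\
  (forall R C, ~ occurs_tbox true (CEx R (CNot C)) T).

Definition horn_kb (K : kb) : Prop := horn_tbox (kb_tbox K).

(* Interpretations interpret individual names as themselves (standard names):
   the domain contains all of them.  Up to renaming of domain elements, this is
   a domain with an injection from the individual names. *)
Record interp := Interp {
  dom : Type;
  iind : individual -> dom;
  iconcept : concept_name -> dom -> Prop;
  irole : role_name -> dom -> dom -> Prop;
  iind_inj : injective iind }.

Fixpoint cext (I : interp) (C : concept) : dom I -> Prop :=
  match C with
  | CName A => iconcept (i := I) A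
  | CTop => fun _ => True
  | CNot D => fun d => ~ cext D d
  | CAnd D E => fun d => cext D d /\ cext E d
  | CEx R D => fun d => exists2 e, irole R d e & cext D e
  end.

Definition sat_inclusion (I : interp) (ci : inclusion) : Prop :=
  forall d : dom I, cext ci.1 d -> cext ci.2 d.

Definition sat_assertion (I : interp) (al : assertion) : Prop :=
  match al with
  | AConcept A a => iconcept A (iind I a)
  | ARole R a b => irole R (iind I a) (iind I b)
  end.

Definition model (I : interp) (K : kb) : Prop :=
  (forall ci, List.In ci (kb_tbox K) -> sat_inclusion I ci) /\
  (forall al, List.In al (kb_abox K) -> sat_assertion I al).

Definition consistent (K : kb) : Prop := exists I, model I K.

Inductive atom :=
| QConcept of concept_name & variable
| QRole of role_name & variable & variable.

Definition atom_vars (at_ : atom) : seq variable :=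
  match at_ with
  | QConcept _ z => [:: z]
  | QRole _ z z' => [:: z; z']
  end.

(* The quantified variables are those of the atoms that are not answer
   variables. *)
Record cq := CQ { answer_vars : seq variable; atoms : seq atom }.

Definition quantified_vars (q : cq) : seq variable :=
  [seq z <- flatten [seq atom_vars at_ | at_ <- atoms q]
     | z \notin answer_vars q].

Definition adjacent (q : cq) : rel variable := fun u v =>
  has (fun at_ => match at_ with
                  | QRole _ z z' => (z == u) && (z' == v) || (z == v) && (z' == u)
                  | QConcept _ _ => false
                  end) (atoms q).

Definition rooted (q : cq) : Prop :=
  forall y, y \in quantified_vars q ->
  exists2 x, x \in answer_vars q
           & exists2 p, path (adjacent q) x p & last x p = y.

Definition sat_atom (I : interp) (pi : variable -> dom I) (at_ : atom) : Prop :=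
  match at_ with
  | QConcept A z => iconcept A (pi z)
  | QRole R z z' => irole R (pi z) (pi z')
  end.

Definition sat_cq (I : interp) (q : cq) (a : seq individual) : Prop :=
  exists2 pi : variable -> dom I,
    map pi (answer_vars q) = map (iind I) a
    & forall at_, List.In at_ (atoms q) -> sat_atom pi at_.

Definition entails_cq (K : kb) (q : cq) (a : seq individual) : Prop :=
  forall I, model I K -> sat_cq I q a.

Record signature := Signature {
  sig_concept : pred concept_name;
  sig_role : pred role_name }.

Definition full_sig : signature := Signature predT predT.

(* Signatures that are part of the input of a decision problem are finite, and
   are given by a list of concept names and a list of role names. *)
Definition finite_sig := (seq concept_name * seq role_name)%type.

Definition sig_of (s : finite_sig) : signature :=
  Signature (fun A => A \in s.1) (fun R => R \in s.2).

Definition atom_over (S : signature) (at_ : atom) : bool :=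
  match at_ with
  | QConcept A _ => sig_concept S A
  | QRole R _ _ => sig_role S R
  end.

Definition cq_over (S : signature) (q : cq) : bool := all (atom_over S) (atoms q).

Inductive query_class := AllCQ | RootedCQ.

Definition in_class (Q : query_class) (q : cq) : Prop :=
  match Q with
  | AllCQ => True
  | RootedCQ => rooted q
  end.

Definition sig_entails (S : signature) (Q : query_class) (K1 K2 : kb) : Prop :=
  forall (q : cq) (a : seq individual),
    in_class Q q -> cq_over S q ->
    size a = size (answer_vars q) -> {subset a <= ind K2} ->
    entails_cq K2 q a -> {subset a <= ind K1} /\ entails_cq K1 q a.

Definition sig_inseparable (S : signature) (Q : query_class) (K1 K2 : kb) : Prop :=
  sig_entails S Q K1 K2 /\ sig_entails S Q K2 K1.

(* [CodeSeq.code] is a computable bijection from [seq nat] to [nat]. *)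
Definition code : seq nat -> nat := CodeSeq.code.

Fixpoint encode_concept (C : concept) : nat :=
  match C with
  | CName A => code [:: 0; A]
  | CTop => code [:: 1]
  | CNot D => code [:: 2; encode_concept D]
  | CAnd D E => code [:: 3; encode_concept D; encode_concept E]
  | CEx R D => code [:: 4; R; encode_concept D]
  end.

Definition encode_inclusion (ci : inclusion) : nat :=
  code [:: encode_concept ci.1; encode_concept ci.2].

Definition encode_assertion (al : assertion) : nat :=
  match al with
  | AConcept A a => code [:: 0; A; a]
  | ARole R a b => code [:: 1; R; a; b]
  end.

Definition encode_kb (K : kb) : nat :=
  code [:: code (map encode_inclusion (kb_tbox K));
           code (map encode_assertion (kb_abox K))].

Definition encode_sig (s : finite_sig) : nat := code [:: code s.1; code s.2].

Record kb_pair := KBPair { kb1 : kb; kb2 : kb }.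

Definition encode_kb_pair (p : kb_pair) : nat :=
  code [:: encode_kb (kb1 p); encode_kb (kb2 p)].

Definition encode_kb_pair_sig (x : kb_pair * finite_sig) : nat :=
  code [:: encode_kb (kb1 x.1); encode_kb (kb2 x.1); encode_sig x.2].

(* A Horn-ALC KB and an ALC KB, both consistent since query entailment between
   KBs is only defined for consistent ones. *)
Definition horn_alc_pair (p : kb_pair) : Prop :=
  [/\ horn_kb (kb1 p), consistent (kb1 p) & consistent (kb2 p)].

(* Main.v *)
From Stdlib Require Import Classical ClassicalEpsilon FunctionalExtensionality.
Require Import Defs.
From mathcomp Require Import all_boot zify.

Set Implicit Arguments.
Unset Strict Implicit.
Unset Printing Implicit Defensive.

(**
The two knowledge bases have the same ABox, and the TBox of the Horn one is
empty; hence entailment and inseparability coincide, and the full signature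
makes no difference because the auxiliary letters are never names but concepts
[~ ex Z. T], which no query can see and which the ABox refutes for its own
individuals.

The ABox contains a gadget absorbing every query except those with a path from
a [Start] variable to an [End] variable all of whose variables carry a label.
The TBox of the larger knowledge base generates a tree of words below
individual 0. At every final letter [d] the interpretation may choose: either
[End] holds at [d], or it holds at the last nonfinal ancestor of [d]. If a
labelled path matches the tree up to some such [d] and up to some such ancestor
but never both on the same branch, then the choice can be made so that the path
never matches. So the path is entailed iff it matches a single branch in two
ways, shifted against each other by the length of the final part of the branch.

This compares consecutive rows of a word, so branches matched twice encode
runs of a register machine, one row per configuration, with the registers in
unary. Recursive functions compile to such machines. Given a decision procedure
[f], the machine that computes the encoding of an instance and accepts iff [f]
answers 1 is run on the codes of its own knowledge bases: it accepts iff the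
larger one has no new consequences, that is, iff it does not accept.
*)

(** * Branching systems and their knowledge bases *)

Lemma In_cat (T : Type) (x : T) s1 s2 :
  List.In x (s1 ++ s2) <-> List.In x s1 \/ List.In x s2.
Proof. by elim: s1 => [|y s IH] /=; tauto. Qed.

Lemma In_map (S : eqType) (T : Type) (f : S -> T) s y :
  List.In y (map f s) <-> exists2 x, x \in s & y = f x.
Proof.
elim: s => [|x s IH] /=; first by split=> // -[].
split=> [[<-|/IH[z zs ->]]|[z]].
- by exists x; rewrite ?mem_head.
- by exists z; rewrite // in_cons zs orbT.
- by rewrite in_cons => /orP[/eqP->|zs] e; [left|right; apply/IH; exists z].
Qed.

Lemma In_flatten (S : Type) (T : eqType) (f : S -> seq T) s x :
  x \in flatten (map f s) <-> exists2 y, List.In y s & x \in f y.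
Proof.
elim: s => [|y s IH] /=; first by split=> // -[? []].
rewrite mem_cat; split.
  case/orP=> [xy|/IH[z zs xz]]; first by exists y; [left|].
  by exists z; [right|].
case=> z [->|zs] xz; apply/orP; [by left|right].
by apply/IH; exists z.
Qed.

Lemma In_has (T : Type) (p : pred T) x s : List.In x s -> p x -> has p s.
Proof. by elim: s => //= y s IH [->->//|/IH H /H->]; rewrite orbT. Qed.

(** * Gadget ABox, branching TBox and double matches *)

Definition aA : concept_name := 0.
Definition aStart : concept_name := 1.
Definition aEnd : concept_name := 2.
Definition rR : role_name := 0.
Definition rG : role_name := 1.
Definition aLab (n : nat) : concept_name := n.+3.
Definition rLet (n : nat) : role_name := n.+2.

Definition hid (r : role_name) : concept := CNot (CEx r CTop).

(** The only part of the two knowledge bases that varies with the numbers on which a fixed machine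
    is run. *)
Definition prefix_concept (ns : seq nat) : concept :=
  foldr (fun n D => CEx rR (CAnd (hid (rLet n)) D)) CTop ns.

(** Labels are letters again: an element with letter [b] carries every label [l] with [lab b l], so
    different letters can share a label. That is how one path can match two different pieces of a
    branch. *)
Record branching := Branching {
  letter : finType;
  name : letter -> nat;
  name_inj : injective name;
  child : rel letter;
  lab : rel letter;
  start : pred letter;
  fin : pred letter }.

Section Branching.
Variable B : branching.
Local Notation X := (letter B).
Implicit Types (b l : X) (w : seq X) (i j : individual).

Definition gadget_roles : seq role_name :=
  rG :: [seq rLet (name b) | b <- enum X].

(* Individual 0 is the root of the tree. A labelled path of a query from a start
   goes to 2, other labelled variables go to 1 and unlabelled ones to 3; the role
   edges to 4 refute all letters. *)
Definition gadget_concepts i : seq concept_name :=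
  let labs := [seq aLab (name b) | b <- enum X] in
  nth [::] [:: [:: aA]; aEnd :: labs; aStart :: labs; [:: aStart; aEnd]] i.

Definition gadget_succ i : seq individual :=
  nth [::] [:: [:: 0; 1; 2; 3]; [:: 1; 2; 3]; [:: 2; 3]; [:: 1; 2; 3]] i.

Definition gadget : abox :=
  [seq AConcept p.2 p.1 | p <- [seq (i, A) | i <- iota 0 5, A <- gadget_concepts i]] ++
  [seq ARole rR p.1 p.2 | p <- [seq (i, j) | i <- iota 0 5, j <- gadget_succ i]] ++
  [seq ARole p.2 p.1 4 | p <- [seq (i, r) | i <- iota 0 5, r <- gadget_roles]].

Definition on_letters (f : X -> inclusion) (P : pred X) : tbox :=
  [seq f b | b <- enum P].

Definition on_pairs (f : X -> X -> inclusion) (P : rel X) : tbox :=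
  [seq f p.1 p.2 | p <- enum [pred p : X * X | P p.1 p.2]].

Definition hlet b := hid (rLet (name b)).

(** The last three groups express the choice at a final letter: without [End] it satisfies [hid rG],
    which climbs through final ancestors and turns into [End] at the nearest nonfinal one. *)
Definition branch_tbox : tbox :=
  on_pairs (fun b b' => (hlet b, CEx rR (hlet b'))) (@child B) ++
  on_pairs (fun b l => (hlet b, CName (aLab (name l)))) (@lab B) ++
  on_letters (fun b => (hlet b, CName aStart)) (@start B) ++
  on_letters (fun b => (CAnd (hlet b) (CNot (CName aEnd)), hid rG)) (@fin B) ++
  on_letters (fun b => (CAnd (hlet b) (CEx rR (hid rG)), hid rG)) (@fin B) ++
  on_letters (fun b => (CAnd (hlet b) (CEx rR (hid rG)), CName aEnd))
    (predC (@fin B)).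

Lemma In_on_letters f (P : pred X) ci :
  List.In ci (on_letters f P) <-> exists2 b, P b & ci = f b.
Proof.
rewrite In_map; split=> -[b Pb ->]; exists b => //.
  by rewrite mem_enum in Pb.
by rewrite mem_enum.
Qed.

Lemma In_on_pairs f (P : rel X) ci :
  List.In ci (on_pairs f P) <-> exists b b', P b b' /\ ci = f b b'.
Proof.
rewrite In_map; split=> [[[b b'] Pb ->]|[b [b' [Pb ->]]]].
  by exists b, b'; rewrite mem_enum in Pb.
by exists (b, b') => //; rewrite mem_enum.
Qed.

Variable pfx : seq X.

Definition kb_small : kb := KB [::] gadget.
Definition kb_big : kb :=
  KB ((CName aA, prefix_concept (map (@name B) pfx)) :: branch_tbox) gadget.

(* Words are written backwards: the head is the most recent letter. *)
Inductive branch : seq X -> Prop :=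
| branch_prefix u x v : pfx = u ++ x :: v -> branch (x :: rev u)
| branch_child b b' w : branch (b :: w) -> child b b' -> branch (b' :: b :: w).

(** Labels are listed backwards like words, so the last one has to sit on a start letter; [w] may
    continue beyond it towards the root. *)
Fixpoint matches (ls w : seq X) : bool :=
  match ls, w with
  | l :: ls', b :: w' =>
      lab b l && (if ls' is [::] then start b else matches ls' w')
  | _, _ => false
  end.

Definition ends_early (ls w : seq X) : Prop :=
  exists t b w', [/\ w = t ++ b :: w', t != [::], all (@fin B) t, ~~ fin b
                   & matches ls (b :: w')].

Definition double_match : Prop :=
  exists ls w, [/\ branch w, ends_early ls w & matches ls w].

Lemma gadgetP al : List.In al gadget <->
  match al with
  | AConcept A i => A \in gadget_concepts i
  | ARole r i j => (r == rR) && (j \in gadget_succ i)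
                   || [&& r \in gadget_roles, i < 5 & j == 4]
  end.
Proof.
have gc i : 4 < i -> gadget_concepts i = [::].
  by move=> ?; rewrite /gadget_concepts nth_default //=; lia.
have gs i : 4 < i -> gadget_succ i = [::] by move=> ?; rewrite /gadget_succ nth_default //=; lia.
have i5 i : (i \in iota 0 5) = (i < 5) by rewrite mem_iota.
rewrite /gadget !In_cat !In_map; split.
- case=> [[p /allpairsPdep[i [A [_ ? ->]]] ->] //|].
  case=> [[p /allpairsPdep[i [j [_ ? ->]]] ->]|[p /allpairsPdep[i [r [ii ? ->]]] ->]].
    by apply/orP; left.
  by apply/orP; right; rewrite i5 in ii; apply/and3P; split.
- case: al => [A i|r i j].
    move=> Ai; left; exists (i, A) => //; apply/allpairsPdep; exists i, A; split=> //.
    by rewrite i5 ltnNge; apply/negP => /gc E; rewrite E in Ai.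
  move=> /orP[/andP[/eqP-> ij]|/and3P[rr ii /eqP->]]; right; [left|right].
    exists (i, j) => //; apply/allpairsPdep; exists i, j; split=> //.
    by rewrite i5 ltnNge; apply/negP => /gs E; rewrite E in ij.
  by exists (i, r) => //; apply/allpairsPdep; exists i, r; rewrite i5.
Qed.


(** * The model that avoids a given labelled path *)

Section Adversary.
Variable ls : seq X.

Definition end_late w : Prop :=
  exists t, [/\ branch (t ++ w), all (@fin B) t & ~ ends_early ls (t ++ w)].

(** A final word gets [End] itself exactly when [ls] matches at its last nonfinal ancestor;
    otherwise that ancestor, if there is one, gets [End], and there [ls] does not match. *)
Definition has_end w : Prop :=
  match w with
  | [::] => False
  | b :: w' => if fin b then ends_early ls w
               else exists t, [/\ t != [::], branch (t ++ w), all (@fin B) t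
                                & ~ ends_early ls (t ++ w)]
  end.

Definition tree_hid (r : role_name) w : Prop :=
  match w with
  | [::] => False
  | b :: w' => branch w /\ (r = rLet (name b) \/ r = rG /\ fin b /\ end_late w)
  end.

Definition tree_concept (A : concept_name) w : Prop :=
  match w with
  | [::] => False
  | b :: w' => branch w /\ [\/ exists2 l, lab b l & A = aLab (name l),
                             A = aStart /\ start b | A = aEnd /\ has_end w]
  end.

Definition adv_concept (A : concept_name) (d : individual + seq X) : Prop :=
  match d with
  | inl i => A \in gadget_concepts i
  | inr w => tree_concept A w
  end.

Definition adv_succ (d e : individual + seq X) : Prop :=
  match d, e with
  | inl i, inl j => j \in gadget_succ i
  | inl i, inr w => i = 0 /\ exists2 x, w = [:: x] & branch w
  | inr w, inr w' => w <> [::] /\ exists2 b, w' = b :: w & branch w'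
  | inr _, inl _ => False
  end.

Definition adv_role (r : role_name) (d e : individual + seq X) : Prop :=
  if r == rR then adv_succ d e
  else [/\ r \in gadget_roles, e = inl 4
         & if d is inr w then ~ tree_hid r w else True].

Lemma adv_inj : injective (@inl individual (seq X)).
Proof. by move=> i j []. Qed.

Definition adversary : interp := Interp adv_concept adv_role adv_inj.

Lemma gadget_roleG : rG \in gadget_roles.
Proof. exact: mem_head. Qed.

Lemma gadget_roleL b : rLet (name b) \in gadget_roles.
Proof. by rewrite in_cons; apply/orP; right; apply/mapP; exists b; rewrite ?mem_enum. Qed.

Lemma rR_gadget_role : rR \notin gadget_roles.
Proof. by rewrite in_cons negb_or /=; apply/negP => /mapP[]. Qed.

Lemma adv_hid r (d : dom adversary) : r \in gadget_roles ->
  cext (hid r) d <-> if d is inr w then tree_hid r w else False.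
Proof.
move=> rr; have r0 : (r == rR) = false.
  by apply/eqP => E; rewrite E in rr; case/negP: rR_gadget_role.
split=> /= [H|]; rewrite /= /adv_role.
  case: d H => [i|w] H; first by case: H; exists (inl 4); rewrite //= /adv_role r0.
  apply: NNPP => N; case: H; exists (inl 4); rewrite //= /adv_role r0; split=> //.
by case: d => [//|w] H [e]; rewrite r0 => -[].
Qed.

Lemma adv_hlet b (d : dom adversary) :
  cext (hlet b) d <-> exists w, d = inr (b :: w) /\ branch (b :: w).
Proof.
rewrite adv_hid ?gadget_roleL //; split.
  case: d => [//|[//|c w] /= [bw]] [[/name_inj->]|[]//]; by exists w.
by case=> w [-> bw]; split; [|left].
Qed.

Lemma adv_hG (d : dom adversary) :
  cext (hid rG) d <-> exists b w, [/\ d = inr (b :: w), branch (b :: w), fin b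
                                  & end_late (b :: w)].
Proof.
rewrite adv_hid ?gadget_roleG //; split.
  case: d => [//|[//|c w] /= [bw]] [//|[_ [? ?]]]; by exists c, w.
by case=> c [w [-> bw ? ?]]; split; [|right].
Qed.

(** The root of the tree is individual 0 and not the empty word, hence the case distinction on
    [u]. *)
Lemma adv_prefix u v : pfx = u ++ v ->
  cext (I := adversary) (prefix_concept (map (@name B) v))
       (if u is [::] then inl 0 else inr (rev u)).
Proof.
elim: v u => [//|x v IH] u E.
have bx : branch (x :: rev u) by apply: branch_prefix E.
exists (inr (x :: rev u)).
  rewrite /= /adv_role eqxx /=; case: u E bx => [|c u] E bx /=.
    by split=> //; exists x.
  by split; [rewrite rev_cons; case: (rev u)|exists x].
split; first by apply/(@adv_hlet x); exists (rev u).
move: (IH (rcons u x)); rewrite cat_rcons => /(_ E).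
by rewrite rev_rcons; case: (rcons u x) (size_rcons u x).
Qed.

Lemma gadget_root i : aA \in gadget_concepts i -> i = 0.
Proof.
have labs A : aA \in [seq aLab (name b) | b <- A] = false by apply/negP => /mapP[].
by case: i => [|[|[|[|i]]]] //; rewrite /gadget_concepts /= ?in_cons ?labs // nth_nil.
Qed.

Lemma adversary_model : model adversary kb_big.
Proof.
split=> [ci|al].
- case=> [<- [i /gadget_root->|[//|b w] [_ [[]|[]|[]]]] //|].
    exact: (@adv_prefix [::]).
  rewrite -/(List.In ci branch_tbox) /branch_tbox !In_cat.
  case; [|case; [|case; [|case; [|case]]]].
  + case/In_on_pairs=> b [b' [nb ->]] d /= /adv_hlet[w [-> bw]].
    have bw' := branch_child bw nb.
    exists (inr (b' :: b :: w)); last by apply/adv_hlet; exists (b :: w).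
    by rewrite /adv_role eqxx /=; split=> //; exists b'.
  + case/In_on_pairs=> b [l [bl ->]] d /= /adv_hlet[w [-> bw]] /=.
    by split=> //; constructor 1; exists l.
  + by case/In_on_letters=> b bl -> d /= /adv_hlet[w [-> bw]] /=; split=> //; constructor 2.
  (* A final word without [End] does not end early, so the empty extension witnesses [end_late]. *)
  + case/In_on_letters=> b bl -> d [/adv_hlet[w [-> bw]] /= N]; apply/adv_hG.
    exists b, w; split=> //; exists [::]; split=> // U; case: N; split=> //.
    by constructor 3; rewrite bl.
  + case/In_on_letters=> b bl -> d [/adv_hlet[w [-> bw]] [e]] /= S
      /adv_hG[c [w' [E cw cf [t [tb tf nU]]]]].
    apply/adv_hG; exists b, w; split=> //.
    rewrite E /adv_role /= in S; case: S => _ [x [Ex ? _]]; subst.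
    (* The extension that witnesses the successor, with the letter [x] of the successor put in front
       of it, witnesses the word itself; words being backwards, this is [rcons]. *)
    by exists (rcons t x); rewrite cat_rcons all_rcons cf.
  + case/In_on_letters=> b bl -> d [/adv_hlet[w [-> bw]] [e]] /= S
      /adv_hG[c [w' [E cw cf [t [tb tf nU]]]]].
    split=> //; constructor 3; split=> //; rewrite (negbTE bl).
    rewrite E /adv_role /= in S; case: S => _ [x [Ex ? _]]; subst.
    by exists (rcons t x); rewrite cat_rcons all_rcons cf; split=> //; case: (t).
- move/gadgetP; case: al => [A i|r i j] //= /orP[/andP[/eqP-> ij]|/and3P[rr i5 /eqP->]].
    by rewrite /adv_role eqxx.
  rewrite /adv_role; case: eqP => E //; by rewrite E (negbTE rR_gadget_role) in rr.
Qed.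

End Adversary.

(** * Queries with and without a labelled path *)

Fixpoint query_path (q : cq) (ls : seq X) (y : variable) : Prop :=
  match ls with
  | [::] => False
  | l :: ls' =>
      List.In (QConcept (aLab (name l)) y) (atoms q) /\
      if ls' is [::] then List.In (QConcept aStart y) (atoms q)
      else exists2 y', List.In (QRole rR y' y) (atoms q) & query_path q ls' y'
  end.

Lemma gadget_lab b i : aLab (name b) \in gadget_concepts i -> i = 1 \/ i = 2.
Proof.
by case: i => [|[|[|[|i]]]]; rewrite ?nth_nil //; [left|right|rewrite /gadget_concepts /= nth_nil].
Qed.

Lemma gadget_labE b i : i = 1 \/ i = 2 -> aLab (name b) \in gadget_concepts i.
Proof. by case=> ->; rewrite in_cons /=; apply/mapP; exists b; rewrite ?mem_enum. Qed.

Lemma gadget_start i : aStart \in gadget_concepts i -> i = 2 \/ i = 3.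
Proof.
have labs s : aStart \in [seq aLab (name b) | b <- s] = false by apply/negP => /mapP[].
by case: i => [|[|[|[|i]]]]; rewrite /gadget_concepts /= ?in_cons ?labs ?nth_nil //; [left|right].
Qed.

Lemma gadget_end i : aEnd \in gadget_concepts i -> i = 1 \/ i = 3.
Proof.
have labs s : aEnd \in [seq aLab (name b) | b <- s] = false by apply/negP => /mapP[].
by case: i => [|[|[|[|i]]]]; rewrite /gadget_concepts /= ?in_cons ?labs ?nth_nil //; [left|right].
Qed.

(* In the gadget every labelled path from a start leads into individual 2. *)
Lemma query_path_adversary ls0 ls q (h : variable -> dom (adversary ls0)) y :
  (forall at_, List.In at_ (atoms q) -> sat_atom h at_) -> query_path q ls y ->
  h y = inl 2 \/ exists w, [/\ h y = inr w, matches ls w & branch w].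
Proof.
move=> hq; elim: ls y => [//|l ls IH] y [ly P].
have {}ly := hq _ ly; rewrite /= in ly.
case: ls IH P => [|l' ls] IH.
  move=> /hq /=; case: (h y) ly => [i|[|b w]] //=.
    by move=> /gadget_lab[] -> // /gadget_start[] // _; left.
  case=> bw [[l1 bl /= [/name_inj ll]]|[]//|[]//] [_ [[]//|[_ sb]|[]//]].
  by right; exists (b :: w); rewrite /= ll bl sb.
case=> y' /hq R /IH H; have [{H IH}Hy|{H IH}[w' [Hy mw bw]]] := H.
  move: ly R; rewrite /= Hy /adv_role eqxx /=; case: (h y) => [i|w] /=.
    by move/gadget_lab => -[->|->] // _; left.
  by move=> _ [].
move: ly R; rewrite /= Hy /adv_role eqxx /=; case: (h y) => [//|w] /=.
case: w => [//|b w] [_ [[l1 bl /= [/name_inj ll]]|[]//|[]//]] [_ [b' [e1 e2] bw']].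
subst; right; exists (b' :: w'); split=> //.
by rewrite bl.
Qed.

(** The adversary is built for the labels of this very path. There the path cannot end in individual
    2, which lacks [End], so it ends at a word that matches [ls] and has [End]. By the choice made
    in [has_end] this word is final and ends early as well. *)
Lemma entailed_path_double_match q a ls y :
  entails_cq kb_big q a -> query_path q ls y ->
  List.In (QConcept aEnd y) (atoms q) -> double_match.
Proof.
move=> /(_ _ (adversary_model ls)) [h _ hq] P /hq /= E.
case: (query_path_adversary hq P) E => [->/gadget_end[]//|[w [-> mw bw]]] /=.
case: w mw bw => [//|b w] mw bw [_ [[]//|[]//|[_ /=]]].
case: ifP => fb.
  by move=> U; exists ls, (b :: w).
case=> t [t0 tb ft []]; exists t, b, w; split=> //; exact: negbT.
Qed.

Definition labelled (q : cq) (y : variable) : Prop :=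
  exists l, List.In (QConcept (aLab (name l)) y) (atoms q).

(** Folds the adversary into the gadget. In the adversary the individuals beyond 4 have no concepts
    and only edges to 4, which 4 has too, so they are sent to 4. *)
Definition gadget_image q (h : variable -> individual + seq X) y : individual :=
  match h y with
  | inl i => minn i 4
  | inr _ => if excluded_middle_informative (exists ls, query_path q ls y) then 2
             else if excluded_middle_informative (labelled q y) then 1 else 3
  end.

Lemma gadget_concepts_lt A i : A \in gadget_concepts i -> i < 4.
Proof. by case: i => [|[|[|[|i]]]] //; rewrite /gadget_concepts /= nth_nil. Qed.

Lemma gadget_succ_lt i j : j \in gadget_succ i -> (i < 4) && (j < 4).
Proof.
by case: i => [|[|[|[|i]]]]; rewrite /gadget_succ /= ?nth_nil // ?inE; lia.
Qed.

Lemma mem_ind T i : (i \in ind (KB T gadget)) = (i < 5).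
Proof.
have E : i \in ind (KB T gadget) <->
         (exists2 al, List.In al gadget & i \in assertion_inds al) := In_flatten _ _ _.
apply/idP/idP=> [/E[al /gadgetP]|i5].
  case: al => [A j|r j k] /=.
    by rewrite inE => /gadget_concepts_lt ? /eqP->; lia.
  rewrite !inE => /orP[/andP[_ /gadget_succ_lt]|/and3P[_ ? /eqP->]].
    by move=> ? /orP[]/eqP->; lia.
  by case/orP=> /eqP->.
apply/E; exists (ARole rG i 4); last by rewrite mem_head.
by apply/gadgetP; rewrite gadget_roleG i5.
Qed.

(** A match in an adversary is folded into the gadget. Among 1, 2, 3 the only missing [rR] edge is
    the one from 2 to 1, and it is never hit: a labelled successor of the end of a path prolongs the
    path and goes to 2. That 2 lacks [End] does no harm, by the hypothesis on paths. *)
Lemma no_path_entails_small q a : {subset a <= ind kb_small} ->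
  entails_cq kb_big q a ->
  (forall ls y, query_path q ls y -> ~ List.In (QConcept aEnd y) (atoms q)) ->
  entails_cq kb_small q a.
Proof.
move=> aK /(_ _ (adversary_model [::])) [h ha hq] nP J [_ JA].
pose g := gadget_image q h.
have a5 i : i \in a -> i < 5 by move/aK; rewrite mem_ind.
exists (fun y => iind J (g y)).
  rewrite (map_comp (iind J)); congr map.
  move: ha a5; clear aK; elim: (answer_vars q) a => [|y ys IH] [|i a'] //= [hy ha'] a5.
  rewrite (IH a' ha') => [|j ja]; last by apply: a5; rewrite in_cons ja orbT.
  rewrite /g /gadget_image hy; congr cons; apply/minn_idPl.
  by have := a5 i (mem_head _ _).
have gtree y w : h y = inr w -> [\/ g y = 1, g y = 2 | g y = 3].
  rewrite /g /gadget_image => ->; case: (excluded_middle_informative _) => [?|?]; first by constructor 2.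
  by case: (excluded_middle_informative _) => [?|?]; [constructor 1|constructor 3].
move=> [A y|r y z] yq.
  apply: (JA (AConcept A (g y))); apply/gadgetP; move: (hq _ yq) => /=.
  rewrite /g /gadget_image; case: (h y) => [i|w] /=.
    move=> Ai; have i4 := gadget_concepts_lt Ai.
    by rewrite (minn_idPl _) // ltnW.
  case: w => [//|b w] [bw H].
  case: (excluded_middle_informative _) => [[ls P]|nLs].
    case: H => [[l bl ->]|[-> _] //|[E _]].
      by apply: gadget_labE; right.
    by rewrite E in yq; case: (nP _ _ P).
  case: (excluded_middle_informative _) => [[l ly]|nl].
    case: H => [[l' bl ->]|[E _] //|[-> _] //].
      by apply: gadget_labE; left.
    by case: nLs; exists [:: l]; split; rewrite -?E.
  case: H => [[l bl E]|[-> _] //|[-> _] //].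
  by case: nl; exists l; rewrite -E.
apply: (JA (ARole r (g y) (g z))); apply/gadgetP; move: (hq _ yq) => /=.
rewrite /adv_role; case: eqP => [Er|_] /=; first subst r; last first.
  case=> rr hz _; apply/and3P; split=> //.
    case E: (h y) => [i|w]; first by rewrite /g /gadget_image E; lia.
    by case: (gtree _ _ E) => ->.
  by rewrite /g /gadget_image hz.
move=> R; apply/orP; left; case Ey: (h y) R => [i|w]; case Ez: (h z) => [j|w'] //.
- have gi y' k : h y' = inl k -> g y' = minn k 4 by move=> E; rewrite /g /gadget_image E.
  rewrite (gi _ _ Ey) (gi _ _ Ez).
  by move=> ij; case/andP: (gadget_succ_lt ij) => i4 j4; rewrite !(minn_idPl _) // ltnW.
- case=> i0 _; have -> : g y = 0 by rewrite /g /gadget_image Ey i0.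
  by case: (gtree _ _ Ez) => ->.
- move=> _; case: (excluded_middle_informative (exists ls, query_path q ls y)) => Py.
    have zz : labelled q z -> g z = 2.
      case=> l lz; rewrite /g /gadget_image Ez.
      case: (excluded_middle_informative _) => [//|[]]; case: Py => ls P.
      exists (l :: ls); split=> //; case: ls P => // l' ls P; by exists y.
    have -> : g y = 2.
      by rewrite /g /gadget_image Ey; case: (excluded_middle_informative _).
    case: (excluded_middle_informative (labelled q z)) => [/zz->//|nl].
    rewrite /g /gadget_image Ez; case: (excluded_middle_informative _) => [?|?] //.
    by case: (excluded_middle_informative _).
  rewrite {2}/g /gadget_image Ey.
  case: (excluded_middle_informative _) => [//|?].
  by case: (excluded_middle_informative _) => [?|?]; case: (gtree _ _ Ez) => ->.
Qed.

Lemma no_double_match_entails S Q : ~ double_match -> sig_entails S Q kb_small kb_big.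
Proof.
move=> nD q a _ _ _ aK Kq; split=> //.
apply: no_path_entails_small => // ls y P E.
exact: nD (entailed_path_double_match Kq P E).
Qed.

Lemma big_entails_small S Q : sig_entails S Q kb_big kb_small.
Proof.
move=> q a _ _ _ aK Kq; split=> //.
by move=> I [_ IA]; apply: Kq; split.
Qed.

(** * The query witnessing a double match *)

Section Witness.
Variable J : interp.
Hypothesis Jmodel : model J kb_big.

(** The element [e n] is reached from individual 0 after [n] letters; as words are backwards, it
    belongs to the suffix of [w] of size [n]. *)
Definition unfolds (w : seq X) (e : nat -> dom J) : Prop :=
  e 0 = iind J 0 /\
  forall v b w', w = v ++ b :: w' ->
    irole rR (e (size w')) (e (size w').+1) /\ cext (hlet b) (e (size w').+1).

Lemma unfolds_suffix v w e : unfolds (v ++ w) e -> unfolds w e.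
Proof. by case=> e0 H; split=> // v' b w' E; apply: (H (v ++ v')); rewrite E catA. Qed.

Lemma unfolds_cons w e b d : unfolds w e -> irole rR (e (size w)) d ->
  cext (hlet b) d -> unfolds (b :: w) (fun i => if i <= size w then e i else d).
Proof.
move=> [e0 H] R Hb; split=> // -[|c v] b' w' [? E]; subst.
  by rewrite leqnn ltnn.
have lt : size w' < size (v ++ b' :: w') by rewrite size_cat /= addnS ltnS leq_addl.
by rewrite lt ltnW //; apply: (H v).
Qed.

Lemma branch_tbox_sat ci : List.In ci branch_tbox -> sat_inclusion J ci.
Proof. by move=> H; apply: (proj1 Jmodel); right. Qed.

Lemma unfolds_branch w : branch w -> exists e, unfolds w e.
Proof.
elim=> [{w} u x v E|b b' w' _ [e U] nb]; last first.
  have /branch_tbox_sat sat : List.In (hlet b, CEx rR (hlet b')) branch_tbox.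
    by rewrite /branch_tbox In_cat; left; apply/In_on_pairs; exists b, b'.
  have [|d R Hd] := sat (e (size w').+1); first by have [_ /(_ [::] _ _ erefl)[]] := U.
  by exists (fun i => if i <= size (b :: w') then e i else d); apply: unfolds_cons.
have A0 : cext (prefix_concept (map (@name B) pfx)) (iind J 0).
  apply: (proj1 Jmodel (CName aA, _)); first by left.
  by apply: (proj2 Jmodel (AConcept aA 0)); apply/gadgetP.
(* The letters [u1] are realised already, while [u2] is still to be unfolded from the remaining
   concept. *)
suff H u1 u2 e : unfolds (rev u1) e ->
    cext (prefix_concept (map (@name B) (u2 ++ x :: v))) (e (size u1)) ->
    exists e, unfolds (x :: rev u2 ++ rev u1) e.
  have [||e U] := H [::] u (fun _ => iind J 0).
  - by split=> // -[|? ?].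
  - by rewrite -E.
  by exists e; rewrite cats0 in U.
elim: u2 u1 e => [|y u2 IH] u1 e U /= [d R [Hd P]].
  by exists (fun i => if i <= size (rev u1) then e i else d); apply: unfolds_cons; rewrite ?size_rev.
have [||e' U'] := IH (rcons u1 y) (fun i => if i <= size (rev u1) then e i else d).
- by rewrite rev_rcons; apply: unfolds_cons; rewrite ?size_rev.
- by rewrite size_rcons size_rev ltnn.
- by exists e'; rewrite rev_cons cat_rcons -rev_rcons.
Qed.

(** If the end lacks [End], then [hid rG] holds there, climbs through the final letters of [t], and
    from the child of [b] forces [End] at [b]. *)
Lemma final_choice t b w e : unfolds (t ++ b :: w) e -> t != [::] ->
  all (@fin B) t -> ~~ fin b ->
  iconcept aEnd (e (size (t ++ b :: w))) \/ iconcept aEnd (e (size (b :: w))).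
Proof.
case: t => [//|c t] U _ ft fb.
case: (classic (iconcept aEnd (e (size (c :: t ++ b :: w))))) => [|N]; [by left|right].
have G : cext (hid rG) (e (size (c :: t ++ b :: w))).
  have [_ /(_ [::] _ _ erefl)[_ Hc]] := U.
  case/andP: ft => fc _.
  have /branch_tbox_sat sat : List.In (CAnd (hlet c) (CNot (CName aEnd)), hid rG) branch_tbox.
    by rewrite /branch_tbox !In_cat; do 3!right; left; apply/In_on_letters; exists c.
  exact: sat.
elim: t c U ft G {N} => [|c' t IH] c U ft G.
  have [_ /(_ [::] _ _ erefl)[R _]] := U.
  have [_ /(_ [:: c] _ _ erefl)[_ Hb]] := U.
  have /branch_tbox_sat sat :
      List.In (CAnd (hlet b) (CEx rR (hid rG)), CName aEnd) branch_tbox.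
    by rewrite /branch_tbox !In_cat; do 5!right; apply/In_on_letters; exists b.
  by apply: sat; split=> //; exists (e (size (c :: b :: w))).
apply: (IH c').
- exact: (@unfolds_suffix [:: c]).
- by case/andP: ft.
have [_ /(_ [::] _ _ erefl)[R _]] := U.
have [_ /(_ [:: c] _ _ erefl)[_ Hb]] := U.
case/and3P: ft => _ fc _.
have /branch_tbox_sat sat :
    List.In (CAnd (hlet c') (CEx rR (hid rG)), hid rG) branch_tbox.
  by rewrite /branch_tbox !In_cat; do 4!right; left; apply/In_on_letters; exists c'.
by apply: sat; split=> //; exists (e (size (c :: c' :: t ++ b :: w))).
Qed.

Fixpoint label_atoms (ls : seq X) (n : nat) : seq atom :=
  match ls with
  | [::] => [::]
  | l :: ls' => QConcept (aLab (name l)) n ::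
      if ls' is [::] then [:: QConcept aStart n] else label_atoms ls' n.-1
  end.

Lemma label_atoms_sat ls k w e at_ : unfolds w e -> matches ls w ->
  List.In at_ (label_atoms ls (size w + k)) -> sat_atom (fun i => e (i - k)) at_.
Proof.
elim: ls w => [//|l ls IH] [//|b w] U /= /andP[bl M].
have [_ /(_ [::] _ _ erefl)[_ Hb]] := U.
case=> [<-|].
  rewrite /= addnK.
  have /branch_tbox_sat sat : List.In (hlet b, CName (aLab (name l))) branch_tbox.
    by rewrite /branch_tbox !In_cat; right; left; apply/In_on_pairs; exists b, l.
  exact: sat.
case: ls IH M => [_ sb|l' ls IH M].
  case=> // <-; rewrite /= addnK.
  have /branch_tbox_sat sat : List.In (hlet b, CName aStart) branch_tbox.
    by rewrite /branch_tbox !In_cat; do 2!right; left; apply/In_on_letters; exists b.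
  exact: sat.
by apply: IH M; apply: (@unfolds_suffix [:: b]).
Qed.

(** Subtraction is truncated, so the variables up to [k] all go to individual 0, whose [rR] loop
    absorbs the edges between them. Thus a chain made for a longer word also maps to a shorter one,
    shifted by [k]. *)
Lemma role_atoms_sat k w e i : unfolds w e -> i < size w + k ->
  irole rR (e (i - k)) (e (i.+1 - k)).
Proof.
move=> [e0 U] ik; case: (leqP k i) => ki; last first.
  have -> : i - k = 0 by lia.
  have -> : i.+1 - k = 0 by lia.
  by rewrite e0; apply: (proj2 Jmodel (ARole rR 0 0)); apply/gadgetP.
rewrite subSn //; have lt : i - k < size w by lia.
(* The letter leading from depth [j] to [j.+1] stands at position [m] of the backward word. *)
set j := i - k in lt *; set m := (size w - j).-1.
have [b Eb] : exists b, w = take m w ++ b :: drop m.+1 w.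
  case: w @m {U ik} lt => [//|b0 w] m lt.
  exists (nth b0 (b0 :: w) m); rewrite -drop_nth ?cat_take_drop //.
  by rewrite /m /=; lia.
have [R _] := U _ _ _ Eb; rewrite size_drop in R.
have E : size w - m.+1 = j by rewrite /m; lia.
by rewrite E in R.
Qed.

End Witness.

(** The chain starting at the answer variable makes the query rooted, so that one query serves both
    classes; the labels sit on the last [size ls] variables. *)
Definition witness (ls w : seq X) : cq :=
  CQ [:: 0] (QConcept aEnd (size w) :: [seq QRole rR i i.+1 | i <- iota 0 (size w)]
             ++ label_atoms ls (size w)).

Lemma matches_size ls w : matches ls w -> size ls <= size w.
Proof.
elim: ls w => [|l ls IH] [|b w] //= /andP[_]; rewrite ltnS.
by case: ls IH => // l' ls IH; apply: IH.
Qed.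

Lemma witness_atomP ls w at_ : List.In at_ (atoms (witness ls w)) <->
  [\/ at_ = QConcept aEnd (size w),
      exists2 i, i < size w & at_ = QRole rR i i.+1
    | List.In at_ (label_atoms ls (size w))].
Proof.
rewrite /= In_cat In_map; split.
  case=> [<-|[[i ii ->]|]]; [by constructor 1| |by constructor 3].
  by constructor 2; exists i; rewrite // mem_iota in ii.
case=> [->|[i ii ->]|]; [by left| |by right; right].
by right; left; exists i; rewrite // mem_iota.
Qed.

Lemma witness_path ls w : ls != [::] -> size ls <= size w ->
  query_path (witness ls w) ls (size w).
Proof.
suff Hl ls1 n : n <= size w ->
    (forall at_, List.In at_ (label_atoms ls1 n) -> List.In at_ (atoms (witness ls w))) ->
    ls1 != [::] -> size ls1 <= n -> query_path (witness ls w) ls1 n.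
  by apply: Hl => // at_ H; apply/witness_atomP; constructor 3.
elim: ls1 n => [//|l ls1 IH] n nw H _ ln.
split; first by apply: H; left.
case: ls1 IH ln H => [_ _ H|l' ls1 IH ln H]; first by apply: H; right; left.
case: n ln nw H => // n ln nw H; exists n.
  by apply/witness_atomP; constructor 2; exists n.
by apply: IH => // [|at_ a]; [exact: ltnW|apply: H; right].
Qed.

Lemma label_atoms_vars ls n at_ y : List.In at_ (label_atoms ls n) ->
  y \in atom_vars at_ -> y <= n.
Proof.
elim: ls n => [//|l ls IH] n /= [<-|]; first by rewrite inE => /eqP->.
case: ls IH => [_ [<-|//]|l' ls IH /IH H /H]; first by rewrite inE => /eqP->.
by move=> ?; apply: leq_trans (leq_pred n).
Qed.

Lemma witness_rooted ls w : rooted (witness ls w).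
Proof.
move=> y; rewrite mem_filter => /andP[_ /In_flatten[at_ /witness_atomP H yv]].
have yw : y <= size w.
  case: H yv => [->|[i ii ->]|/label_atoms_vars H /H //]; rewrite !inE.
    by move/eqP->.
  by case/orP=> /eqP->; rewrite // ltnW.
exists 0; first exact: mem_head.
exists (iota 1 y).
  suff H0 k m : k + m <= size w -> path (adjacent (witness ls w)) k (iota k.+1 m).
    exact: H0.
  elim: m k => [//|m IH] k km /=; rewrite IH ?andbT ?addSnnS //.
  apply: (@In_has _ _ (QRole rR k k.+1)); last by rewrite !eqxx.
  by apply/witness_atomP; constructor 2; exists k; rewrite // (leq_trans _ km) // addnS ltnS leq_addr.
by rewrite -[y in RHS]add0n; elim: y 0 {H yv yw} => [|y IH] m; rewrite ?addn0 //= IH addSnnS.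
Qed.

Lemma witness_over S ls w : sig_role S rR -> sig_concept S aStart -> sig_concept S aEnd ->
  (forall b, sig_concept S (aLab (name b))) -> cq_over S (witness ls w).
Proof.
move=> SR SS SE SL; rewrite /cq_over /= SE all_cat /=; apply/andP; split.
  by rewrite all_map; apply/allP => i _.
elim: ls (size w) => [//|l ls IH] n /=; rewrite SL.
case: ls IH => [_|l2 ls IH]; first by rewrite /= SS.
exact: (IH n.-1).
Qed.

(** In every model [End] holds at the tip of the branch or at its last nonfinal letter. In the first
    case the chain is mapped along the whole branch, in the second it is shifted by the size of the
    final part. *)
Lemma double_match_witness : double_match ->
  exists ls w, [/\ ls != [::], size ls <= size w & entails_cq kb_big (witness ls w) [:: 0]].
Proof.
case=> ls [w [bw [t [b [w' [E t0 ft fb M']]]] M]].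
exists ls, w; split; [by case: (ls) M|exact: matches_size|].
move=> J Jm; have [e U] := unfolds_branch Jm bw.
have U' : unfolds (b :: w') e by rewrite E in U; exact: unfolds_suffix U.
have [] : iconcept aEnd (e (size w)) \/ iconcept aEnd (e (size (b :: w'))).
- by rewrite E in U *; exact: (final_choice Jm U).
- move=> F; exists (fun i => e (i - 0)); first by rewrite /= (proj1 U).
  move=> at_ /=; rewrite In_cat => -[<-|[/In_map[i ii ->]|]]; first by rewrite /= subn0.
    by apply: (role_atoms_sat Jm U); rewrite mem_iota in ii; rewrite addn0.
  by rewrite -[size w]addn0; apply: (label_atoms_sat Jm U).
- have sw : size w = size (b :: w') + size t by rewrite E size_cat addnC.
  move=> F; exists (fun i => e (i - size t)); first by rewrite /= sub0n (proj1 U).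
  move=> at_ /=; rewrite In_cat => -[<-|[/In_map[i ii ->]|]]; first by rewrite /= sw addnK.
    by apply: (role_atoms_sat Jm U'); rewrite mem_iota in ii; rewrite -sw.
  by rewrite sw; apply: (label_atoms_sat Jm U').
Qed.

End Branching.

Arguments branch_prefix {B pfx} u x v.

Section Entailment.
Variables (B : branching) (pfx : seq (letter B)).
Local Notation X := (letter B).

Lemma not_branch_nil (w : seq X) : ~ branch (B := B) [::] w.
Proof. by elim=> // -[]. Qed.

(* With an empty prefix the adversary is just the gadget, a model of [kb_small]. *)
Lemma small_not_entails_path q a (ls : seq X) y : query_path q ls y ->
  List.In (QConcept aEnd y) (atoms q) -> ~ entails_cq (kb_small B) q a.
Proof.
move=> P E /(_ (adversary (B := B) [::] [::])) [].
  by split=> // al H; apply: (proj2 (adversary_model (B := B) [::] [::])).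
move=> h _ hq; case: (query_path_adversary hq P) (hq _ E) => /=.
  by move=> -> /gadget_end[].
by case=> w [_ _ /not_branch_nil].
Qed.

Lemma double_match_not_entails S Q :
  sig_role S rR -> sig_concept S aStart -> sig_concept S aEnd ->
  (forall b : X, sig_concept S (aLab (name b))) ->
  double_match pfx -> ~ sig_entails S Q (kb_small B) (kb_big pfx).
Proof.
move=> SR SS SE SL /double_match_witness[ls [w [l0 lw Kq]]] H.
have [||||_] := H (witness ls w) [:: 0] _ _ _ _ Kq.
- by case: Q {H} => //; exact: witness_rooted.
- exact: witness_over.
- by [].
- by move=> i; rewrite inE => /eqP->; rewrite mem_ind.
by apply: small_not_entails_path (witness_path l0 lw) _; left.
Qed.

Lemma small_consistent : consistent (kb_small B).
Proof.
exists (adversary (B := B) [::] [::]).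
by split=> // al H; apply: (proj2 (adversary_model (B := B) [::] [::])).
Qed.

Lemma big_consistent : consistent (kb_big pfx).
Proof. by exists (adversary pfx [::]); apply: adversary_model. Qed.

Lemma small_horn : horn_kb (kb_small B).
Proof. by split=> [C|R C] [D [E []]]. Qed.

End Entailment.

(** * Register programs for recursive functions *)

Definition store := nat -> nat.

Definition upd (s : store) (i v : nat) : store := fun j => if j == i then v else s j.

Inductive op := Nop | Inc of nat | Dec of nat | IfZero of nat.

Definition op_step (o : op) (s s' : store) : Prop :=
  match o with
  | Nop => s' = s
  | Inc i => s' = upd s i (s i).+1
  | Dec i => 0 < s i /\ s' = upd s i (s i).-1
  | IfZero i => s i = 0 /\ s' = s
  end.

Inductive prog := Prim of op | Seq of prog & prog | Star of prog.

Inductive star (R : store -> store -> Prop) : store -> store -> Prop :=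
| star_refl s : star R s s
| star_step s1 s2 s3 : R s1 s2 -> star R s2 s3 -> star R s1 s3.

Fixpoint exec (p : prog) : store -> store -> Prop :=
  match p with
  | Prim o => op_step o
  | Seq p1 p2 => fun s s' => exists2 s1, exec p1 s s1 & exec p2 s1 s'
  | Star p => star (exec p)
  end.

(** [Star] is nondeterministic, but every round needs a positive register [i] and the exit needs a
    zero one, so the number of rounds is forced. *)
Definition while i p := Seq (Star (Seq (Prim (Dec i)) p)) (Prim (IfZero i)).
Definition clear i := while i (Prim Nop).
Definition move i j := while i (Prim (Inc j)).
Definition copy i j t := Seq (while i (Seq (Prim (Inc j)) (Prim (Inc t)))) (move t i).

Definition clear_block m k := foldr (fun i p => Seq (clear (m + i)) p) (Prim Nop) (iota 0 k).

(* Register allocation: the arguments are in the registers [args], the result is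
   added to the empty register [out], and the registers from [m] on are scratch,
   zero before and after. *)
Fixpoint compile n (f : recfun n) : n.-tuple nat -> nat -> nat -> prog :=
  match f in recfun n return n.-tuple nat -> nat -> nat -> prog with
  | RZero _ => fun _ _ _ => Prim Nop
  | RSucc => fun args out m => Seq (copy (thead args) out m) (Prim (Inc out))
  | RProj _ i => fun args out m => copy (tnth args i) out m
  | RComp k _ f g => fun args out m =>
      foldr (fun i p => Seq (compile (g i) args (m + i) (m + k)) p)
        (Seq (compile f [tuple m + i | i < k] out (m + k)) (clear_block m k))
        (enum 'I_k)
  | RPrim _ f g => fun args out m =>
      Seq (compile f (behead_tuple args) m (m + 4))
     (Seq (copy (thead args) (m + 2) (m + 4))
     (Seq (while (m + 2)
            (Seq (compile g [tuple of m + 1 :: m :: behead_tuple args] (m + 3) (m + 4))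
            (Seq (clear m) (Seq (move (m + 3) m) (Prim (Inc (m + 1)))))))
     (Seq (move m out) (clear (m + 1)))))
  | RMin _ f => fun args out m =>
      let eval := compile f [tuple of m :: args] (m + 1) (m + 2) in
      Seq eval
     (Seq (while (m + 1) (Seq (clear (m + 1)) (Seq (Prim (Inc m)) eval)))
          (move m out))
  end.

Ltac store_ext :=
  apply: functional_extensionality => ?; rewrite /upd;
  repeat (case: eqP => ?); subst; try lia; try congruence.

Lemma exec_while i p s s' : exec (while i p) s s' <->
  if s i == 0 then s' = s
  else exists2 s1, exec p (upd s i (s i).-1) s1 & exec (while i p) s1 s'.
Proof.
split.
  case=> s1 H [z ->]; case: H z => [s2 ->//|s2 s3 s4 [s5 /= [s20 ->] P] St z].
  by rewrite eqn0Ngt s20 /=; exists s3 => //; exists s4.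
case: eqP => [z ->|nz [s1 P [s2 St Z]]].
  by exists s => //; exact: star_refl.
exists s2 => //; apply: star_step St; exists (upd s i (s i).-1) => //=.
by split=> //; lia.
Qed.

Lemma exec_seq p1 p2 s s' : exec (Seq p1 p2) s s' <-> exists2 s1, exec p1 s s1 & exec p2 s1 s'.
Proof. by []. Qed.

Lemma exec_clear i s s' : exec (clear i) s s' <-> s' = upd s i 0.
Proof.
rewrite /clear; move E: (s i) => n; elim: n s E => [|n IH] s E; rewrite exec_while E /=.
  by have -> : upd s i 0 = s by store_ext.
have {}IH := IH (upd s i n); rewrite {1}/upd eqxx in IH.
have -> : upd s i 0 = upd (upd s i n) i 0 by store_ext.
by split=> [[_ -> /(IH erefl)]|/(IH erefl) H]; [exact|exists (upd s i n)].
Qed.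

Lemma exec_move i j s s' : i != j ->
  exec (move i j) s s' <-> s' = upd (upd s i 0) j (s j + s i).
Proof.
move/eqP=> ij; move E: (s i) => n; elim: n s E => [|n IH] s E; rewrite exec_while E /=.
  by have -> : upd (upd s i 0) j (s j + 0) = s by store_ext.
set s1 := upd (upd s i n) j (upd s i n j).+1.
have Ei : s1 i = n by rewrite /s1 /upd; repeat case: eqP => //.
have {}IH := IH s1 Ei.
have -> : upd (upd s i 0) j (s j + n.+1) = upd (upd s1 i 0) j (s1 j + n).
  by rewrite /s1; clear IH Ei s1; store_ext.
by split=> [[_ -> /IH]|]; [exact|exists s1 => //; apply/IH].
Qed.

Lemma exec_copy i j t s s' : i != j -> i != t -> j != t -> s t = 0 ->
  exec (copy i j t) s s' <-> s' = upd s j (s j + s i).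
Proof.
move=> ij it jt t0.
suff W s1 s2 : exec (while i (Seq (Prim (Inc j)) (Prim (Inc t)))) s1 s2 <->
    s2 = upd (upd (upd s1 i 0) j (s1 j + s1 i)) t (s1 t + s1 i).
  have E s2 : s2 = upd (upd (upd s i 0) j (s j + s i)) t (s t + s i) ->
      upd (upd s2 t 0) i (s2 i + s2 t) = upd s j (s j + s i).
    by move=> ->; move: ij it jt => /eqP ij /eqP it /eqP jt; store_ext.
  rewrite /copy exec_seq; split=> [[s2 /W/E H]|->].
    by rewrite exec_move 1?eq_sym // H.
  exists (upd (upd (upd s i 0) j (s j + s i)) t (s t + s i)); first exact/W.
  by rewrite exec_move 1?eq_sym // E.
move: ij it jt => /eqP ij /eqP it /eqP jt.
move E: (s1 i) => n; elim: n s1 E => [|n IH] s1 E; rewrite exec_while E /=.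
  have -> // : upd (upd (upd s1 i 0) j (s1 j + 0)) t (s1 t + 0) = s1 by store_ext.
set s3 := upd s1 i n; set s4 := upd s3 j (s3 j).+1; set s5 := upd s4 t (s4 t).+1.
have Ei : s5 i = n by rewrite /s5 /s4 /s3 /upd; repeat case: eqP => //.
have {}IH := IH s5 Ei.
have -> : upd (upd (upd s1 i 0) j (s1 j + n.+1)) t (s1 t + n.+1) =
          upd (upd (upd s5 i 0) j (s5 j + n)) t (s5 t + n).
  by rewrite /s5 /s4 /s3; clear IH Ei s5 s4 s3; store_ext.
split=> [[_ [_ -> ->] /IH]|]; first exact.
by exists s5; [exists s4|apply/IH].
Qed.

Lemma exec_clear_block m k s s' : exec (clear_block m k) s s' <->
  s' = fun j => if m <= j < m + k then 0 else s j.
Proof.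
suff H i s1 : exec (foldr (fun i p => Seq (clear (m + i)) p) (Prim Nop) (iota i k)) s1 s' <->
    s' = fun j => if m + i <= j < m + i + k then 0 else s1 j.
  by rewrite H addn0.
elim: k i s1 => [|k IH] i s1.
  have -> // : (fun j => if m + i <= j < m + i + 0 then 0 else s1 j) = s1.
  by apply: functional_extensionality => j; case: ifP => //; lia.
have -> : (fun j => if m + i <= j < m + i + k.+1 then 0 else s1 j) =
  (fun j => if m + i.+1 <= j < m + i.+1 + k then 0 else upd s1 (m + i) 0 j).
  apply: functional_extensionality => j; rewrite /upd.
  by repeat (case: ifP) => //; lia.
rewrite [foldr _ _ _]/= exec_seq; split=> [[s2 /exec_clear-> /(IH i.+1)//]|H].
by exists (upd s1 (m + i) 0); [exact/exec_clear|exact/(IH i.+1)].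
Qed.

Lemma exec_while_pos i n p s s' : s i = n.+1 ->
  (exists2 s1, exec p (upd s i n) s1 & exec (while i p) s1 s') -> exec (while i p) s s'.
Proof. by move=> E H; apply/exec_while; rewrite E. Qed.

Lemma exec_while_ind i p (P : store -> store -> Prop) :
  (forall s, s i = 0 -> P s s) ->
  (forall s s1 s', 0 < s i -> exec p (upd s i (s i).-1) s1 -> P s1 s' -> P s s') ->
  forall s s', exec (while i p) s s' -> P s s'.
Proof.
move=> P0 PS s s' [s1 St [z ->]]; elim: St z => [s2|s2 s3 s4 [s5 /= [s20 ->] E] _ IH] z.
  exact: P0.
by apply: PS E (IH z).
Qed.

Lemma map_tuple_eq n (s s' : store) (args : n.-tuple nat) :
  {in args, s =1 s'} -> map_tuple s args = map_tuple s' args.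
Proof. by move=> H; apply: val_inj; apply/eq_in_map. Qed.

Lemma map_behead n (s : store) (args : n.+1.-tuple nat) :
  map_tuple s (behead_tuple args) = behead_tuple (map_tuple s args).
Proof. by apply: val_inj; rewrite /= behead_map. Qed.

Lemma map_thead n (s : store) (args : n.+1.-tuple nat) :
  thead (map_tuple s args) = s (thead args).
Proof. by rewrite /thead tnth_map. Qed.

Lemma behead_sub n (args : n.+1.-tuple nat) : {subset behead_tuple args <= args}.
Proof. by move=> x; apply: mem_behead. Qed.

(** An equivalence, because the existence of a run is what the knowledge bases will detect: the
    program must have none where the function is undefined. *)
Definition compiled n (f : recfun n) : Prop := forall (args : n.-tuple nat) out m s s',
  {in args, forall i, i < m} -> out < m -> out \notin args ->
  s out = 0 -> (forall i, m <= i -> s i = 0) ->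
  exec (compile f args out m) s s' <->
  exists2 r, graph f (map_tuple s args) r & s' = upd s out r.

Lemma compiled_comp k n (f : recfun k) (g : 'I_k -> recfun n) :
  compiled f -> (forall i, compiled (g i)) -> compiled (RComp f g).
Proof.
move=> cf cg args out m s s' am om oa so sm.
(* The store once the first [size ws] inner functions have left their values [ws] in the registers
   from [m] on. *)
pose blk (ws : seq nat) : store := fun x => if m <= x < m + size ws then nth 0 ws (x - m) else s x.
set v := map_tuple s args.
rewrite [compile _ _ _ _]/=; set rest := Seq _ (clear_block m k).
have restP ws : size ws = k -> exec rest (blk ws) s' <->
    exists2 r, graph f (mktuple (fun i : 'I_k => nth 0 ws i)) r & s' = upd s out r.
  move=> sw; have H s2 : exec (compile f [tuple m + i | i < k] out (m + k)) (blk ws) s2 <->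
      exists2 r, graph f (mktuple (fun i : 'I_k => nth 0 ws i)) r & s2 = upd (blk ws) out r.
    rewrite cf.
    - have -> // : map_tuple (blk ws) [tuple m + i | i < k] = mktuple (fun i : 'I_k => nth 0 ws i).
      apply: eq_from_tnth => i; rewrite tnth_map !tnth_mktuple /blk sw.
      by rewrite leq_addr ltn_add2l ltn_ord /= addKn.
    - by move=> x /mapP[i _ ->]; rewrite ltn_add2l.
    - by rewrite (leq_trans om) ?leq_addr.
    - by apply/negP => /mapP[i _ E]; lia.
    - by rewrite /blk leqNgt om.
    - by move=> i mi; rewrite /blk sw ltnNge mi andbF; apply: sm; lia.
  have E r : (fun j => if m <= j < m + k then 0 else upd (blk ws) out r j) = upd s out r.
    apply: functional_extensionality => j; rewrite /upd /blk sw; case: ifP => [jm|->//].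
    by case: eqP => [?|_]; [lia|rewrite sm //; case/andP: jm].
  rewrite /rest exec_seq; split=> [[s2 /H[r gr ->] /exec_clear_block]|[r gr ->]].
    by rewrite E; exists r.
  by exists (upd (blk ws) out r); [apply/H; exists r|apply/exec_clear_block; rewrite E].
(* Here [l] lists the inner functions still to be evaluated, and [ws] the values found so far. *)
have main l ws : map val l = iota (size ws) (k - size ws) -> size ws <= k ->
  exec (foldr (fun i p => Seq (compile (g i) args (m + i) (m + k)) p) rest l) (blk ws) s' <->
  exists ws2, [/\ size (ws ++ ws2) = k,
    forall i : 'I_k, size ws <= i -> graph (g i) v (nth 0 (ws ++ ws2) i)
    & exec rest (blk (ws ++ ws2)) s'].
  elim: l ws => [|i l IH] ws El wk.
    have Ek : size ws = k by move/(congr1 size): El; rewrite size_iota /=; lia.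
    split=> [R|[ws2 [Es _ R]]].
      by exists [::]; rewrite cats0; split=> // i; rewrite Ek leqNgt ltn_ord.
    by case: ws2 Es R => [|x ws2]; rewrite ?cats0 // size_cat /=; lia.
  have lt : size ws < k by move/(congr1 size): El; rewrite size_iota /=; lia.
  have [Ei Hl] : val i = size ws /\ map val l = iota (size ws).+1 (k - (size ws).+1).
    by move: El; rewrite -(subnSK lt) => -[].
  have G s2 : exec (compile (g i) args (m + i) (m + k)) (blk ws) s2 <->
      exists2 r, graph (g i) v r & s2 = blk (rcons ws r).
    have Eb r : upd (blk ws) (m + i) r = blk (rcons ws r).
      apply: functional_extensionality => j; rewrite /upd /blk size_rcons nth_rcons Ei.
      by case: eqP => [->|nj]; repeat case: ifP; rewrite ?addKn ?eqxx //; lia.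
    have Ev : map_tuple (blk ws) args = v.
      by apply: map_tuple_eq => x /am xm; rewrite /blk leqNgt xm.
    rewrite cg ?Ev.
    - by split=> [] [r gr ->]; exists r; rewrite ?Eb.
    - by move=> x /am; lia.
    - by rewrite ltn_add2l.
    - by apply/negP => /am; lia.
    - by rewrite /blk Ei ltnn andbF sm // leq_addr.
    - by move=> j jm; rewrite /blk; case: ifP => ?; [lia|apply: sm; lia].
  rewrite [foldr _ _ _]/= exec_seq; split.
    case=> s2 /G[r gr ->] /IH [||ws2 [Es gs R]]; rewrite ?size_rcons //.
    exists (r :: ws2); rewrite -cat_rcons; split=> // j; rewrite leq_eqVlt => /orP[/eqP ij|].
      have -> : j = i by apply: val_inj; rewrite Ei.
      by rewrite nth_cat size_rcons Ei ltnSn nth_rcons ltnn eqxx.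
    by move=> ?; apply: gs; rewrite size_rcons.
  case=> -[|r ws2] [Es gs R]; first by rewrite cats0 in Es; lia.
  exists (blk (rcons ws r)).
    by apply/G; exists r => //; have := gs i; rewrite Ei leqnn nth_cat ltnn subnn; apply.
  apply/IH; rewrite ?size_rcons //; exists ws2; rewrite cat_rcons; split=> // j ij.
  by apply: gs; rewrite ltnW.
have b0 : blk [::] = s.
  by apply: functional_extensionality => j; rewrite /blk addn0; case: ifP => //; lia.
rewrite -{1}b0 main ?subn0 ?val_enum_ord //=; split.
  case=> ws [Es gs /restP[//|r fr ->]]; exists r => //.
  by exists (mktuple (fun i : 'I_k => nth 0 ws i)) => // i; rewrite tnth_mktuple; apply: gs.
case=> r [w gw fw] Es'; exists w; rewrite size_tuple; split=> //.
  by move=> i _; rewrite -tnth_nth.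
apply/restP; first by rewrite size_tuple.
exists r => //.
have -> // : mktuple (fun i : 'I_k => nth 0 w i) = w.
by apply: eq_from_tnth => i; rewrite tnth_mktuple -tnth_nth.
Qed.

Lemma compiled_prim n (f : recfun n) (g : recfun n.+2) :
  compiled f -> compiled g -> compiled (RPrim f g).
Proof.
move=> cf cg args out m s s' am om oa so sm.
set v := map_tuple s args.
have ta : thead args < m by apply: am; exact: mem_tnth.
have ba x : x \in behead_tuple args -> x < m by move/behead_sub/am.
(* Accumulator in [m], counter in [m + 1], remaining rounds in [m + 2]; [m + 3] receives the value
   of [g]. *)
pose L acc cnt xc := upd (upd (upd s m acc) (m + 1) cnt) (m + 2) xc.
have Lv acc cnt xc : map_tuple (L acc cnt xc) (behead_tuple args) = behead_tuple v.
  by rewrite -map_behead; apply: map_tuple_eq => x /ba xm; rewrite /L /upd; repeat case: eqP; lia.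
pose body := Seq (compile g [tuple of m + 1 :: m :: behead_tuple args] (m + 3) (m + 4))
  (Seq (clear m) (Seq (move (m + 3) m) (Prim (Inc (m + 1))))).
have bodyP acc cnt xc s2 : exec body (L acc cnt xc) s2 <->
    exists2 r, graph g [tuple of cnt :: acc :: behead_tuple v] r & s2 = L r cnt.+1 xc.
  have H s3 : exec (compile g [tuple of m + 1 :: m :: behead_tuple args] (m + 3) (m + 4))
                (L acc cnt xc) s3 <->
      exists2 r, graph g [tuple of cnt :: acc :: behead_tuple v] r
               & s3 = upd (L acc cnt xc) (m + 3) r.
    rewrite cg.
    - have -> // : map_tuple (L acc cnt xc) [tuple of m + 1 :: m :: behead_tuple args] =
                   [tuple of cnt :: acc :: behead_tuple v].
      apply: val_inj; rewrite /=; congr [:: _, _ & _]; last first.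
        exact: (congr1 val (Lv acc cnt xc)).
        by rewrite /L /upd; repeat case: eqP; lia.
      by rewrite /L /upd; repeat case: eqP; lia.
    - by move=> x; rewrite !inE => /or3P[/eqP->|/eqP->|/ba]; lia.
    - by lia.
    - by rewrite !inE !negb_or; apply/and3P; split; [lia|lia|apply/negP => /ba; lia].
    - by rewrite /L /upd; repeat case: eqP; try lia; move=> *; apply: sm; lia.
    - by move=> i mi; rewrite /L /upd; repeat case: eqP; try lia; move=> *; apply: sm; lia.
  have E1 r : exec (Seq (clear m) (Seq (move (m + 3) m) (Prim (Inc (m + 1)))))
     (upd (L acc cnt xc) (m + 3) r) s2 <-> s2 = L r cnt.+1 xc.
    set s3 := upd (upd (L acc cnt xc) (m + 3) r) m 0.
    set s4 := upd (upd s3 (m + 3) 0) m (s3 m + s3 (m + 3)).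
    have E : upd s4 (m + 1) (s4 (m + 1)).+1 = L r cnt.+1 xc.
      have z3 : s (m + 3) = 0 by apply: sm; lia.
      have -> : s4 (m + 1) = cnt by rewrite /s4 /s3 /L /upd; repeat case: eqP; lia.
      have -> : s4 = upd (upd s3 (m + 3) 0) m r.
        by congr upd; rewrite /s3 /L /upd; repeat case: eqP; lia.
      by rewrite /s3 /L; clear s3 s4; store_ext.
    have m3 : m + 3 != m by lia.
    rewrite !exec_seq; split=> [[_ /exec_clear-> [_ /(exec_move _ _ m3)-> ->]] //|->].
    exists s3; first exact/exec_clear.
    by exists s4; [exact/exec_move|rewrite /= E].
  rewrite /body exec_seq; split=> [[_ /H[r gr ->] /E1->]|[r gr Es2]]; first by exists r.
  by exists (upd (L acc cnt xc) (m + 3) r); [apply/H; exists r|apply/E1].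
have loop xc acc cnt s2 : exec (while (m + 2) body) (L acc cnt xc) s2 <->
    exists t : nat -> nat, [/\ t 0 = acc,
      forall i, i < xc -> graph g [tuple of cnt + i :: t i :: behead_tuple v] (t i.+1)
      & s2 = L (t xc) (cnt + xc) 0].
  elim: xc acc cnt => [|xc IH] acc cnt; rewrite exec_while.
    have -> /= : L acc cnt 0 (m + 2) = 0 by rewrite /L /upd eqxx.
    split=> [->|[t [t0 _ ->]]]; last by rewrite t0 addn0.
    by exists (fun _ => acc); rewrite addn0.
  have -> /= : L acc cnt xc.+1 (m + 2) = xc.+1 by rewrite /L /upd eqxx.
  have -> : upd (L acc cnt xc.+1) (m + 2) xc = L acc cnt xc by rewrite /L; store_ext.
  split.
    case=> s3 /bodyP[r gr ->] /IH[t [t0 gt ->]].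
    exists (fun i => if i is j.+1 then t j else acc); split=> //; last by rewrite addnS.
    by case=> [|i] ix; [rewrite addn0 t0|rewrite addnS; apply: gt].
  case=> t [t0 gt E2]; exists (L (t 1) cnt.+1 xc).
    by apply/bodyP; exists (t 1) => //; have := gt 0 isT; rewrite addn0 t0.
  apply/IH; exists (fun i => t i.+1); split=> //; last by rewrite E2 addnS.
  by move=> i ix; have := gt i.+1 ix; rewrite addnS.
have F s2 : exec (compile f (behead_tuple args) m (m + 4)) s s2 <->
    exists2 r, graph f (behead_tuple v) r & s2 = upd s m r.
  rewrite cf ?map_behead //.
  - by move=> x /ba; lia.
  - by lia.
  - by apply/negP => /ba; lia.
  - exact: sm.
  - by move=> i mi; apply: sm; lia.
have C r s2 : exec (copy (thead args) (m + 2) (m + 4)) (upd s m r) s2 <->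
    s2 = L r 0 (thead v).
  rewrite exec_copy ?map_thead.
  - have -> // : upd (upd s m r) (m + 2) (upd s m r (m + 2) + upd s m r (thead args)) =
                L r 0 (s (thead args)).
    have s1 : s (m + 1) = 0 by apply: sm; lia.
    have s2' : s (m + 2) = 0 by apply: sm; lia.
    have x0 : upd s m r (m + 2) = 0 by rewrite /upd; case: eqP; lia.
    have xt : upd s m r (thead args) = s (thead args) by rewrite /upd; case: eqP; lia.
    by rewrite x0 xt /L; store_ext.
  - by lia.
  - by lia.
  - by lia.
  - by rewrite /upd; case: eqP => [|_]; [lia|apply: sm; lia].
have Z r c s2 : exec (Seq (move m out) (clear (m + 1))) (L r c 0) s2 <-> s2 = upd s out r.
  have E : upd (upd (upd (L r c 0) m 0) out (L r c 0 out + L r c 0 m)) (m + 1) 0 = upd s out r.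
    have s0 : s m = 0 by apply: sm.
    have s1 : s (m + 1) = 0 by apply: sm; lia.
    have s2' : s (m + 2) = 0 by apply: sm; lia.
    have x0 : L r c 0 out = 0 by rewrite /L /upd; repeat case: eqP; lia.
    have x1 : L r c 0 m = r by rewrite /L /upd; repeat case: eqP; lia.
    by rewrite x0 x1 /L; store_ext.
  have mo : m != out by lia.
  rewrite exec_seq; split=> [[s3 /(exec_move _ _ mo)-> /exec_clear->//]|->].
  eexists; first exact/(exec_move _ _ mo).
  by apply/exec_clear; rewrite E.
rewrite [compile _ _ _ _]/= !exec_seq; split.
  case=> s1 /F[r0 f0 ->] [s2 /C-> [s3 /loop[t [t0 gt ->]] /Z->]].
  by exists (t (thead v)) => //=; exists t; rewrite t0.
case=> r /= [t [f0 gt ->]] ->.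
exists (upd s m (t 0)); first by apply/F; exists (t 0).
exists (L (t 0) 0 (thead v)); first exact/C.
exists (L (t (thead v)) (0 + thead v) 0); first by apply/loop; exists t.
exact/Z.
Qed.

Lemma compiled_min n (f : recfun n.+1) : compiled f -> compiled (RMin f).
Proof.
move=> cf args out m s s' am om oa so sm.
set v := map_tuple s args.
(* Candidate [c] in [m], value of [f] at [c] in [m + 1]. *)
pose L c t := upd (upd s m c) (m + 1) t.
pose eval := compile f [tuple of m :: args] (m + 1) (m + 2).
have evalP c s2 : exec eval (L c 0) s2 <->
    exists2 t, graph f [tuple of c :: v] t & s2 = L c t.
  rewrite /eval cf.
  - have -> : map_tuple (L c 0) [tuple of m :: args] = [tuple of c :: v].
      apply: val_inj; rewrite /=; congr cons; first by rewrite /L /upd; repeat case: eqP; lia.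
      by apply/eq_in_map => x /am xm; rewrite /L /upd; repeat case: eqP; lia.
    have E t : upd (L c 0) (m + 1) t = L c t by rewrite /L; store_ext.
    by split=> -[t ft ->]; exists t.
  - by move=> x; rewrite inE => /orP[/eqP->|/am]; lia.
  - by lia.
  - by rewrite inE negb_or; apply/andP; split; [lia|apply/negP => /am; lia].
  - by rewrite /L /upd; repeat case: eqP; lia.
  - by move=> i mi; rewrite /L /upd; repeat case: eqP; try lia; move=> *; apply: sm; lia.
pose body := Seq (clear (m + 1)) (Seq (Prim (Inc m)) eval).
have bodyP c t s2 : exec body (L c t) s2 <->
    exists2 t', graph f [tuple of c.+1 :: v] t' & s2 = L c.+1 t'.
  have E0 : upd (L c t) (m + 1) 0 = L c 0 by rewrite /L; store_ext.
  have E1 : upd (L c 0) m (L c 0 m).+1 = L c.+1 0.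
    have -> : L c 0 m = c by rewrite /L /upd; repeat case: eqP; lia.
    by rewrite /L; store_ext.
  rewrite /body !exec_seq -evalP; split.
    by case=> _ /exec_clear-> [_ /= ->]; rewrite E0 E1.
  move=> H; exists (L c 0); first by apply/exec_clear.
  by exists (L c.+1 0); rewrite //= E1.
have Lt c t : L c t (m + 1) = t by rewrite /L /upd eqxx.
have Lp c t : upd (L c t.+1) (m + 1) t = L c t by rewrite /L; store_ext.
(* The value at [c] is known through [t] only, so [c] itself is left out of the last clause, and the
   clauses on [t] tell whether the loop stops at once. *)
have loop1 c t s2 : exec (while (m + 1) body) (L c t) s2 ->
    exists r, [/\ c <= r, s2 = L r 0, c = r -> t = 0, c < r -> 0 < t /\ graph f [tuple of r :: v] 0
      & forall i, c < i < r -> exists k, graph f [tuple of i :: v] k.+1].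
  move E: (L c t) => s1 H; elim/exec_while_ind: s1 s2 / H c t E => [s1|s1 s3 s4].
    move=> z c t E; exists c; rewrite -E Lt in z *; split=> //; rewrite ?z ?ltnn // => i; lia.
  move=> pos B IH c t E; subst s1; rewrite Lt in pos B.
  case: t pos B => // t _; rewrite Lp => /bodyP[t' ft' E'].
  case: (IH c.+1 t' (esym E')) => r [cr -> z nz H]; exists r; split=> //.
  - exact: ltnW.
  - lia.
  - move=> _; split=> //; move: cr; rewrite leq_eqVlt => /orP[/eqP e|/nz[]//].
    by rewrite -e -(z e).
  move=> i /andP[]; rewrite leq_eqVlt => /orP[/eqP<- ir|ci ir]; last by apply: H; rewrite ci.
  by have [t0 _] := nz ir; exists t'.-1; rewrite prednK.
have loop2 d c t : (if d is 0 then t = 0 else 0 < t /\ graph f [tuple of c + d :: v] 0) ->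
    (forall i, c < i < c + d -> exists k, graph f [tuple of i :: v] k.+1) ->
    exec (while (m + 1) body) (L c t) (L (c + d) 0).
  elim: d c t => [|d IH] c t.
    by move=> -> _; rewrite addn0 exec_while Lt.
  case: t => [[]//|t] [_ f0] H; apply: (exec_while_pos (Lt _ _)); rewrite Lp.
  case: d IH f0 H => [|d] IH f0 H.
    rewrite addn1 in f0 *; exists (L c.+1 0); first by apply/bodyP; exists 0.
    by rewrite exec_while Lt.
  have [|k fk] := H c.+1; first lia.
  exists (L c.+1 k.+1); first by apply/bodyP; exists k.+1.
  rewrite -[c + _]addSnnS; apply: IH; first by rewrite addSnnS.
  by move=> i ?; apply: H; lia.
have Z r s2 : exec (move m out) (L r 0) s2 <-> s2 = upd s out r.
  have E : upd (upd (L r 0) m 0) out (L r 0 out + L r 0 m) = upd s out r.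
    have s0 : s m = 0 by apply: sm.
    have s1 : s (m + 1) = 0 by apply: sm; lia.
    have x0 : L r 0 out = 0 by rewrite /L /upd; repeat case: eqP; lia.
    have x1 : L r 0 m = r by rewrite /L /upd; repeat case: eqP; lia.
    by rewrite x0 x1 /L; store_ext.
  have mo : m != out by lia.
  by rewrite (exec_move _ _ mo) E.
have L0 : L 0 0 = s.
  have s1 : s (m + 1) = 0 by apply: sm; lia.
  have s0 : s m = 0 by apply: sm.
  by rewrite /L; store_ext.
rewrite [compile _ _ _ _]/= -/eval -/body -{1}L0 !exec_seq; split.
  case=> _ /evalP[t ft ->] [_ /loop1[r [_ -> z nz H]] /Z->]; exists r => //=; split.
    by case: r z nz {H} => [/(_ erefl) z _|r _ /(_ isT)[]//]; rewrite z in ft.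
  move=> i ir; case: i ir => [|i] ir; last exact: H.
  by have [t0 _] := nz ir; exists t.-1; rewrite prednK.
case=> r /= [f0 fi] ->.
have [t ft Ht] : exists2 t, graph f [tuple of 0 :: v] t &
    if r is 0 then t = 0 else 0 < t /\ graph f [tuple of 0 + r :: v] 0.
  case: r f0 fi => [|r] f0 fi; first by exists 0.
  by have [|k fk] := fi 0; [|exists k.+1].
exists (L 0 t); first by apply/evalP; exists t.
exists (L (0 + r) 0); last exact/Z.
by apply: loop2 => // i /andP[_ ir]; apply: fi.
Qed.

Lemma compile_correct n (f : recfun n) : compiled f.
Proof.
elim: f => {n} [n||n i|k n f cf g cg|n f cf g cg|n f cf].
- move=> args out m s s' _ _ _ so _; rewrite /=.
  have E : upd s out 0 = s by store_ext.
  by split=> [->|[r -> ->]]; [exists 0|].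
- move=> args out m s s' am om oa so sm.
  have am' : thead args < m by apply: am; exact: mem_tnth.
  have ao : thead args != out by apply: contraNneq oa => <-; exact: mem_tnth.
  have E : upd (upd s out (s out + s (thead args))) out
    (upd s out (s out + s (thead args)) out).+1 = upd s out (s (thead args)).+1.
    by rewrite so; store_ext.
  have C s2 : exec (copy (thead args) out m) s s2 <-> s2 = upd s out (s out + s (thead args)).
    by apply: exec_copy => //; [lia|lia|apply: sm].
  rewrite [compile _ _ _ _]/= exec_seq; split.
    by case=> _ /C-> /= ->; exists (s (thead args)).+1; rewrite ?map_thead ?E.
  case=> r /= -> ->; rewrite map_thead -E.
  by exists (upd s out (s out + s (thead args))); [apply/C|].
- move=> args out m s s' am om oa so sm.
  have am' : tnth args i < m by apply: am; exact: mem_tnth.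
  have ao : tnth args i != out by apply: contraNneq oa => <-; exact: mem_tnth.
  rewrite [compile _ _ _ _]/= exec_copy ?so //; [|lia|lia|exact: sm].
  split=> [->|[r /= -> ->]]; last by rewrite tnth_map.
  by exists (s (tnth args i)); rewrite //= tnth_map.
- exact: compiled_comp.
- exact: compiled_prim.
- exact: compiled_min.
Qed.

(** * From programs to finite control *)

Inductive run (Q : Type) (T : Q -> Q -> option op) : Q -> store -> Q -> store -> Prop :=
| run_refl q s : run T q s q s
| run_step q q1 q' o s s1 s' : T q q1 = Some o -> op_step o s s1 ->
    run T q1 s1 q' s' -> run T q s q' s'.

Lemma run_trans Q (T : Q -> Q -> option op) q s q1 s1 q2 s2 :
  run T q s q1 s1 -> run T q1 s1 q2 s2 -> run T q s q2 s2.
Proof. by elim=> // ? ? ? ? ? ? ? t o _ IH /IH; apply: run_step t o. Qed.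

Lemma run_map Q Q' (T : Q -> Q -> option op) T' (h : Q -> Q') q s q' s' :
  (forall q1 q2, T' (h q1) (h q2) = T q1 q2) -> run T q s q' s' -> run T' (h q) s (h q') s'.
Proof.
move=> hT; elim=> [? ?|? ? ? ? ? ? ? t o _ IH]; first exact: run_refl.
by apply: run_step o IH; rewrite hT.
Qed.

Fixpoint state (p : prog) : finType :=
  match p with
  | Prim _ => bool
  | Seq p1 p2 => (state p1 + state p2)%type
  | Star p => option (state p)
  end.

Fixpoint initial (p : prog) : state p :=
  match p with
  | Prim _ => false
  | Seq p1 p2 => inl (initial p1)
  | Star p => None
  end.

Fixpoint final (p : prog) : state p :=
  match p with
  | Prim _ => true
  | Seq p1 p2 => inr (final p2)
  | Star p => None
  end.

Definition nop_if (b : bool) : option op := if b then Some Nop else None.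

(** The operation is a function of the two states, so that a pair of states can later record a
    transition. *)
Fixpoint trans (p : prog) : state p -> state p -> option op :=
  match p with
  | Prim o => fun q q' => if ~~ q && q' then Some o else None
  | Seq p1 p2 => fun q q' =>
      match q, q' with
      | inl q, inl q' => trans q q'
      | inr q, inr q' => trans q q'
      | inl q, inr q' => nop_if ((q == final p1) && (q' == initial p2))
      | inr _, inl _ => None
      end
  | Star p => fun q q' =>
      match q, q' with
      | Some q, Some q' => trans q q'
      | None, Some q' => nop_if (q' == initial p)
      | Some q, None => nop_if (q == final p)
      | None, None => None
      end
  end.

(** The invariant of runs started in [s0]: it holds initially, is kept by every step, and in the
    final state amounts to [exec]. *)
Fixpoint partial_exec (p : prog) (s0 : store) : state p -> store -> Prop :=
  match p with
  | Prim o => fun q s => if q then op_step o s0 s else s = s0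
  | Seq p1 p2 => fun q s =>
      match q with
      | inl q => partial_exec s0 q s
      | inr q => exists2 s1, exec p1 s0 s1 & partial_exec s1 q s
      end
  | Star p => fun q s =>
      match q with
      | None => star (exec p) s0 s
      | Some q => exists2 s1, star (exec p) s0 s1 & partial_exec s1 q s
      end
  end.

Lemma star_trans R s1 s2 s3 : star R s1 s2 -> star R s2 s3 -> star R s1 s3.
Proof. by elim=> // ? ? ? r _ IH /IH; apply: star_step r. Qed.

Lemma partial_initial p s : partial_exec s (initial p) s.
Proof.
elim: p s => [o|p1 IH1 p2 IH2|p IH] s //=; exact: star_refl.
Qed.

Lemma partial_final p s0 s : partial_exec s0 (final p) s -> exec p s0 s.
Proof.
elim: p s0 s => [o|p1 IH1 p2 IH2|p IH] s0 s //= [s1 e1 /IH2 e2].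
by exists s1.
Qed.

Lemma partial_step p s0 (q q' : state p) o s s' : partial_exec s0 q s ->
  trans q q' = Some o -> op_step o s s' -> partial_exec s0 q' s'.
Proof.
elim: p s0 q q' s s' => [o'|p1 IH1 p2 IH2|p IH] s0 q q' s s' /=.
- by case: q; case: q' => //= -> [->].
- case: q => q; case: q' => q' //=.
  + exact: IH1.
  + rewrite /nop_if; case: andP => // -[/eqP-> /eqP->] /partial_final e [<-] /= ->.
    by exists s => //; exact: partial_initial.
  + by case=> s1 e P t O; exists s1 => //; apply: IH2 P t O.
- case: q => [q|]; case: q' => [q'|] //=.
  + by case=> s1 e P t O; exists s1 => //; apply: IH P t O.
  + rewrite /nop_if; case: eqP => // -> [s1 e /partial_final P] [<-] /= ->.
    by apply: star_trans e _; apply: star_step P (star_refl _ _).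
  + rewrite /nop_if; case: eqP => // -> e [<-] /= ->.
    by exists s => //; exact: partial_initial.
Qed.

Lemma exec_run p s s' : exec p s s' <-> run (@trans p) (initial p) s (final p) s'.
Proof.
split; last first.
  have H q s1 q' s2 : run (@trans p) q s1 q' s2 -> partial_exec s q s1 -> partial_exec s q' s2.
    by elim=> // ? ? ? ? ? ? ? t o _ IH P; apply: IH; apply: partial_step P t o.
  by move=> /H/(_ (partial_initial _ _))/partial_final.
elim: p s s' => [o|p1 IH1 p2 IH2|p IH] s s' /=.
- by move=> H; apply: run_step H (run_refl _ _ _).
- have t : @trans (Seq p1 p2) (inl (final p1)) (inr (initial p2)) = Some Nop.
    by rewrite /= !eqxx.
  case=> s1 /IH1 R1 /IH2 R2.
  apply: run_trans (run_map (h := inl) _ R1) _ => //.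
  by apply: run_step t (erefl : op_step Nop _ _) (run_map (h := inr) _ R2).
- have t1 : @trans (Star p) None (Some (initial p)) = Some Nop by rewrite /= eqxx.
  have t2 : @trans (Star p) (Some (final p)) None = Some Nop by rewrite /= eqxx.
  elim=> [s1|s1 s2 s3 /IH R _ R3]; first exact: run_refl.
  apply: run_step t1 (erefl : op_step Nop _ _) _.
  apply: run_trans (run_map (h := Some) _ R) _ => //.
  exact: run_step t2 (erefl : op_step Nop _ _) R3.
Qed.

Definition op_bounded (K : nat) (o : op) : bool :=
  match o with Nop => true | Inc i | Dec i | IfZero i => i < K end.

(** Since a program uses finitely many registers, a column of a row needs finitely many bits, and
    the alphabet is finite. *)
Lemma trans_bounded p : exists K, forall (q q' : state p) o,
  trans q q' = Some o -> op_bounded K o.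
Proof.
have mono K K' o : K <= K' -> op_bounded K o -> op_bounded K' o.
  by case: o => //= i KK iK; apply: leq_trans KK.
have nopP b o : nop_if b = Some o -> forall K, op_bounded K o by case: b => // -[<-].
elim: p => [o|p1 [K1 H1] p2 [K2 H2]|p [K H]].
- exists (match o with Nop => 0 | Inc i | Dec i | IfZero i => i.+1 end) => q q' o' /=.
  by case: ifP => // _ [<-] {q q' o'}; case: o => /=.
- exists (maxn K1 K2) => -[q|q] [q'|q'] o //=.
  + by move/H1; apply: mono; rewrite leq_maxl.
  + by move/nopP.
  + by move/H2; apply: mono; rewrite leq_maxr.
- exists K => -[q|] [q'|] o //=; [exact: H|by move/nopP|by move/nopP].
Qed.

(** * Runs as branches of rows *)

Definition next_kind (k : nat) : nat := if k == 4 then 0 else if k == 3 then 1 else k.+1.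

Section Rows.
Variables (Q : finType) (T : Q -> Q -> option op) (qi qf : Q) (K : nat).
Hypothesis T_bounded : forall q q' o, T q q' = Some o -> op_bounded K o.

Definition bits : finType := {ffun 'I_K -> bool}.
Definition control : finType := option (Q * Q)%type.

(* The row of a configuration with register contents [s] is a header followed by
   one cell per column; the cell in column [i] holds the bits [i < s r] and a
   copy of the bits of the preceding column, all true in front of the row. The
   control of a row is the transition taken child, or [None] in the last row.
   The initial configuration gets a row of special letters: 0 is the header, 4
   is padding, and 1, 2, 3 are the cells of the three prefix blocks. Other rows
   have kind 0, 1, 2, 3, 1, 2, 3, 1, ... (kind 4 stands for the special row), so
   that a label shared by two letters tells which of their rows is above. *)
Definition row_letter : finType := ('I_4 * control * option (bits * bits))%type.
Definition tm_letter : finType := ('I_5 + row_letter)%type.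
Implicit Types b l : tm_letter.

Definition tm_name b : nat :=
  match b with
  | inl j => j
  | inr c => 5 + pickle c
  end.

Lemma tm_name_inj : injective tm_name.
Proof.
move=> [j|c] [j'|c'] E.
- by congr inl; apply: val_inj.
- by have := ltn_ord j; rewrite (E : j = 5 + pickle c' :> nat).
- by have := ltn_ord j'; rewrite -(E : 5 + pickle c = j' :> nat).
- by case: E => /(pcan_inj (@pickleK row_letter))->.
Qed.

Definition special (j : nat) : tm_letter := inl (inord j).
Definition header (k : nat) (t : control) : tm_letter := inr (inord k, t, None).
Definition cell (k : nat) (t : control) (p c : bits) : tm_letter :=
  inr (inord k, t, Some (p, c)).

Definition starts (t : control) (q : Q) : bool :=
  if t is Some (q1, _) then q1 == q else q == qf.

Definition full_bits : bits := [ffun=> true].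
Definition empty_bits : bits := [ffun=> false].

(** In column [i] a register of value [v] shows as [i < v]. The bit of [v.+1] there is the preceding
    bit of [v]. A decrement is checked the other way round: the preceding bit of [v.-1] is the bit
    of [v]. In column 0, where [p'] is true by convention, this forces [v] to be positive. *)
Definition op_bits (o : op) (r : 'I_K) (p c p' c' : bool) : bool :=
  match o with
  | Nop => c' == c
  | Inc i => c' == (if r == i :> nat then p else c)
  | Dec i => if r == i :> nat then p' == c else c' == c
  | IfZero i => (c' == c) && ((r == i :> nat) ==> ~~ c)
  end.

(** Relates letters in the same column of consecutive rows, [b] in the upper one. Block [j] of the
    special row counts for the registers [r] with [j <= r.+1 <= 3], so the first three registers
    start with the partial sums of the block lengths, as in [tm_store]. *)
Definition compat b b' : bool :=
  match b, b' with
  | inl j, inr (k', _, x') => (k' == 0 :> nat) &&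
      if x' is Some (_, c') then (j != 0 :> nat) && [forall r, c' r == (j <= r.+1 <= 3)]
      else j == 0 :> nat
  | inr (k, Some (q, q'), x), inr (k', _, x') => (k' == next_kind k :> nat) &&
      match x, x' with
      | None, None => true
      | Some (p, c), Some (p', c') =>
          if T q q' is Some o
          then [forall r, op_bits o r (p r) (c r) (p' r) (c' r)] else false
      | _, _ => false
      end
  | _, _ => false
  end.

(** The row width and the bits of each cell are guessed. A row can be left only after a column of
    zeros, so no register is cut off, and a row without a transition is never left, so final letters
    have only final children. *)
Definition tm_next b b' : bool :=
  match b, b' with
  | inl j, inl j' => (j == 4 :> nat) && (j' == 4 :> nat)
  | inl j, inr (k', t', x') =>
      [&& j == 4 :> nat, k' == 0 :> nat, x' == None & starts t' qi]
  | inr (k, t, x), inr (k', t', Some (p', c')) =>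
      [&& k' == k, t' == t & p' == if x is Some (_, c) then c else full_bits]
  | inr (k, Some (_, q), Some (_, c)), inr (k', t', None) =>
      [&& k' == next_kind k :> nat, c == empty_bits & starts t' q]
  | _, _ => false
  end.

(** A letter shows itself and whatever may stand above it, so a path labelled by rows matches these
    rows and also the ones following them. *)
Definition tm_lab b l : bool := (l == b) || compat l b.

Definition tm_start b : bool :=
  match b with
  | inl j => j == 0 :> nat
  | inr (k, _, x) => (k == 0 :> nat) && (x == None)
  end.

Definition tm_fin b : bool := if b is inr (_, None, _) then true else false.

Definition tm : branching := Branching tm_name_inj tm_next tm_lab tm_start tm_fin.

Variables n1 n2 n3 : nat.

Definition tm_prefix : seq tm_letter :=
  special 0 :: nseq n1 (special 1) ++ nseq n2 (special 2) ++ nseq n3 (special 3) ++ [:: special 4].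

Definition tm_store : store := fun i => nth 0 [:: n1; n1 + n2; n1 + n2 + n3] i.

Definition col_bits (s : store) (i : nat) : bits := [ffun r : 'I_K => i < s r].
Definition prev_bits (s : store) (i : nat) : bits :=
  if i is j.+1 then col_bits s j else full_bits.

Definition block (i : nat) : nat :=
  if i < n1 then 1 else if i < n1 + n2 then 2 else if i < n1 + n2 + n3 then 3 else 4.

Lemma block_bits i r : (block i <= r.+1 <= 3) = (i < tm_store r).
Proof.
by rewrite /block /tm_store; case: r => [|[|[|r]]] /=; rewrite ?nth_nil; repeat case: ifP; lia.
Qed.

Lemma block_lt i : 0 < block i < 5.
Proof. by rewrite /block; repeat case: ifP. Qed.

Definition special_row N := special 0 :: [seq special (block i) | i <- iota 0 N].

Definition row k t s N :=
  header k t :: [seq cell k t (prev_bits s i) (col_bits s i) | i <- iota 0 N].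

Lemma special_row_prefix N : n1 + n2 + n3 < N ->
  special_row N = tm_prefix ++ nseq (N - (n1 + n2 + n3).+1) (special 4).
Proof.
move=> lt; rewrite /special_row /tm_prefix /=; congr cons.
apply: (@eq_from_nth _ (special 4)); first by rewrite size_map size_iota !size_cat !size_nseq /=; lia.
move=> i; rewrite size_map size_iota => iN.
rewrite (nth_map 0) ?size_iota // nth_iota // add0n /block.
rewrite -!catA !nth_cat !size_nseq !nth_nseq /=.
repeat case: ifP => ?; try lia; try by [].
have -> : i - n1 - n2 - n3 = 0 by lia.
by [].
Qed.

Lemma path_iota (X : Type) (e : rel X) (f : nat -> X) m n x :
  e x (f m) -> (forall i, m <= i -> i.+1 < m + n -> e (f i) (f i.+1)) ->
  path e x (map f (iota m n)).
Proof.
elim: n m x => [//|n IH] m x xm H /=; rewrite xm.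
case: n IH H => [//|n] IH H; apply: IH; first by apply: H; lia.
by move=> i mi ?; apply: H; lia.
Qed.

Lemma last_map_iota (X : Type) (f : nat -> X) n x : 
  last x (map f (iota 0 n.+1)) = f n.
Proof. by rewrite -addn1 iotaD map_cat last_cat. Qed.

Lemma inord4 k : k < 4 -> (@inord 3 k : nat) = k.
Proof. by move=> ?; rewrite inordK. Qed.

Lemma next_kind_lt k : k < 5 -> next_kind k < 4.
Proof. by rewrite /next_kind; repeat case: eqP; lia. Qed.

Lemma col_bitsE s i r : col_bits s i r = (i < s r).
Proof. by rewrite /col_bits ffunE. Qed.

Lemma prev_bitsE s i r : prev_bits s i r = (i == 0) || (i.-1 < s r).
Proof. by case: i => [|i]; rewrite /prev_bits ?col_bitsE /full_bits ?ffunE. Qed.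

Lemma all2_cat (S S' : Type) (e : S -> S' -> bool) s1 s2 t1 t2 : size s1 = size t1 ->
  all2 e (s1 ++ s2) (t1 ++ t2) = all2 e s1 t1 && all2 e s2 t2.
Proof. by elim: s1 t1 => [|x s1 IH] [|y t1] //= [/IH->]; rewrite andbA. Qed.

Lemma all2_flip (S S' : Type) (e : S -> S' -> bool) (e' : S' -> S -> bool) s t :
  (forall x y, e x y -> e' y x) -> all2 e s t -> all2 e' t s.
Proof. by move=> H; elim: s t => [|x s IH] [|y t] //= /andP[/H-> /IH]. Qed.

Lemma compat_rows k q q' t s s' o N : k < 4 -> T q q' = Some o -> op_step o s s' ->
  all2 compat (row k (Some (q, q')) s N) (row (next_kind k) t s' N).
Proof.
move=> k4 To st; have k4' : next_kind k < 4 by apply: next_kind_lt; lia.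
rewrite /row /= !inord4 // eqxx /=.
elim: (iota 0 N) => [//|i l IH] /=; rewrite {}IH andbT !inord4 // eqxx To /=.
apply/forallP => r; rewrite !prev_bitsE !col_bitsE.
 case: o To st => [|j|j|j] _ /=.
- by move=> ->.
- by move=> ->; rewrite /upd; case: (@eqP _ (r : nat) j) => [->|//]; apply/eqP; lia.
- by case=> pos ->; rewrite /upd; case: (@eqP _ (r : nat) j) => [->|//]; apply/eqP; lia.
- by case=> z ->; rewrite eqxx; apply/implyP => /eqP->; rewrite z.
Qed.

Lemma compat_special_row t N : all2 compat (special_row N) (row 0 t tm_store N).
Proof.
rewrite /special_row /row /= !inord4 // inordK //=.
elim: (iota 0 N) => [//|i l IH] /=; rewrite {}IH andbT inord4 //=.
have /andP[b0 b5] := block_lt i; rewrite inordK // -lt0n b0.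
by apply/forallP => r; rewrite col_bitsE block_bits.
Qed.

Lemma row_path k t s N : path tm_next (header k t) (behead (row k t s N)).
Proof.
by apply: path_iota => [|i _ _] /=; rewrite !eqxx; case: t => [[]|].
Qed.

Lemma last_row k t s N (x : tm_letter) : 0 < N ->
  last x (row k t s N) = cell k t (prev_bits s N.-1) (col_bits s N.-1).
Proof. by case: N => // N _; exact: (last_map_iota (fun i => cell k t (prev_bits s i) (col_bits s i))). Qed.

Lemma size_row k t s N : size (row k t s N) = N.+1.
Proof. by rewrite /= size_map size_iota. Qed.

Lemma col_bits_empty (s : store) i : (forall r : 'I_K, s r <= i) -> col_bits s i = empty_bits.
Proof. by move=> H; apply/ffunP => r; rewrite col_bitsE ltnNge H /empty_bits ffunE. Qed.

(** [A] holds the rows with a transition and [F] the last row; [V] is [A ++ F] without its first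
    row, so that comparing [A] with [V] compares each row with the next one. *)
Lemma run_rows q s s' : run T q s qf s' -> exists N0, forall N k, N0 < N -> k < 4 ->
  exists t A F V, [/\ starts t q /\ A ++ F = row k t s N ++ V, all2 compat A V,
    all tm_fin F && (F != [::]), ~~ has tm_fin A & sorted tm_next (A ++ F)].
Proof.
move E : qf => q' R; elim: R E => {q q' s s'} [q s <-|q q1 q' o s s1 s' To st _ IH /IH{IH}[N0 IH]].
  exists 0 => N k _ k4; exists None, [::], (row k None s N), [::].
  split=> //=; rewrite ?cats0 //; last exact: row_path.
  by rewrite andbT all_map; apply/allP.
(* Wide enough for the last column, [N.-1], to lie beyond the contents of every register. *)
exists (N0 + \max_(r < K) s r) => N k NN k4.
have sN (r : 'I_K) : s r <= N.-1.
  have : s r <= \max_(r < K) s r by exact: (leq_bigmax (F := fun r : 'I_K => s r)).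
  by move: NN; set m := \max_(r < K) s r; lia.
have k4' : next_kind k < 4 by apply: next_kind_lt; lia.
have [|t [A [F [V [[tq AF] AV Ff Af srt]]]]] := IH N (next_kind k) _ k4'; first lia.
exists (Some (q, q1)), (row k (Some (q, q1)) s N ++ A), F, (A ++ F); split=> //.
- by split; [exact: eqxx|rewrite catA].
- rewrite AF all2_cat ?size_row // AV andbT; exact: compat_rows To st.
- rewrite has_cat negb_or Af andbT /= has_map; apply/hasP => -[] //.
- rewrite -catA AF /row cat_cons /= cat_path row_path /=.
  rewrite AF /= in srt; rewrite srt andbT.
  have -> : last (header k (Some (q, q1)))
      [seq cell k (Some (q, q1)) (prev_bits s i) (col_bits s i) | i <- iota 0 N] = cell k (Some (q, q1)) (prev_bits s N.-1) (col_bits s N.-1).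
    by rewrite -(last_row k (Some (q, q1)) s (header k (Some (q, q1)))) //; lia.
  by rewrite /= !inord4 // tq eqxx (col_bits_empty sN) eqxx.
Qed.

Lemma matches_rcons (ls w1 w2 : seq tm_letter) l b : all2 tm_lab w1 ls ->
  tm_lab b l -> tm_start b -> matches (B := tm) (rcons ls l) (w1 ++ b :: w2).
Proof.
elim: ls w1 => [|l' ls IH] [|b' w1] //=; first by move=> _ -> ->.
case/andP=> -> H bl sb /=; have := IH _ H bl sb.
by case: ls {IH H} => // l2 ls.
Qed.

Lemma all2_rev (S S' : Type) (e : S -> S' -> bool) s1 s2 :
  all2 e s1 s2 -> all2 e (rev s1) (rev s2).
Proof.
elim: s1 s2 => [|x s1 IH] [|y s2] //= /andP[xy H].
have sz : size s1 = size s2 by move: H; rewrite all2E => /andP[/eqP].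
by rewrite !rev_cons -!cats1 all2_cat ?size_rev // IH //= xy.
Qed.

Lemma matches_rev (L U V : seq tm_letter) x y : all2 tm_lab (x :: V) (y :: L) ->
  tm_start x -> matches (B := tm) (rev (y :: L)) (rev (U ++ x :: V)).
Proof.
move=> /= /andP[xy /all2_rev H] sx.
by rewrite rev_cons rev_cat rev_cons cat_rcons; apply: matches_rcons.
Qed.

Lemma branch_rev (B : branching) (pfx p : seq (letter B)) u x : pfx = rcons u x ->
  path (@child B) x p -> branch pfx (rev (pfx ++ p)).
Proof.
move=> E; have br : branch pfx (rev pfx).
  by rewrite {2}E rev_rcons; apply: (branch_prefix u x [::]); rewrite cats1.
elim/last_ind: p => [|p y IH]; first by rewrite cats0.
rewrite rcons_path -rcons_cat rev_rcons => /andP[/IH].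
have -> : last x p = last x (pfx ++ p) by rewrite last_cat E last_rcons.
have : pfx ++ p != [::] by rewrite E; case: (u).
case/lastP: (pfx ++ p) => [//|s z] _.
by rewrite last_rcons rev_rcons => bz zy; exact: branch_child.
Qed.

(** The labels are the special row [S] and all rows but the last. They match [S ++ A] literally,
    ending just before the final row, and match [A ++ F] by compatibility, ending at the tip. *)
Lemma run_double_match s' : run T qi tm_store qf s' -> double_match (B := tm) tm_prefix.
Proof.
move=> R; have [N0 /(_ (N0 + n1 + n2 + n3).+2 0)] := run_rows R.
set N := _.+2 => -[|//|t [A [F [V [[tq AF] AV /andP[Ff F0] Af srt]]]]]; first lia.
pose S := special_row N.
have SA : all2 compat (S ++ A) (A ++ F).
  by rewrite AF all2_cat ?AV ?andbT ?compat_special_row // size_row /= size_map size_iota.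
have lab_own (l : seq tm_letter) : all2 tm_lab l l.
  by elim: l => //= x l ->; rewrite /tm_lab eqxx.
have labA : all2 tm_lab (A ++ F) (S ++ A).
  by apply: all2_flip SA => x y xy; rewrite /tm_lab xy orbT.
exists (rev (S ++ A)), (rev (S ++ (A ++ F))); split.
- rewrite /S special_row_prefix -?catA; last by rewrite /N; lia.
  set d := N - _; rewrite catA -catA; apply: (@branch_rev tm tm_prefix _
    (special 0 :: nseq n1 (special 1) ++ nseq n2 (special 2) ++ nseq n3 (special 3)) (special 4)).
    by rewrite /tm_prefix -cats1 /= -!catA.
  rewrite cat_path; apply/andP; split.
    by elim: d => //= d ->; rewrite !inordK.
  have -> : last (special 4) (nseq d (special 4)) = special 4 by elim: d.
  rewrite AF /= in srt *; rewrite srt andbT /= !inordK //=.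
- have [b [w' Ew]] : exists b w', rev (S ++ A) = b :: w'.
    have : S ++ A != [::] by [].
    by case/lastP: (S ++ A) => [//|w b] _; rewrite rev_rcons; exists b, (rev w).
  exists (rev F), b, w'; rewrite -Ew; split.
  + by rewrite -rev_cat catA.
  + by rewrite -size_eq0 size_rev size_eq0.
  + by rewrite all_rev.
  + have : ~~ has tm_fin (rev (S ++ A)).
      rewrite has_rev has_cat negb_or Af andbT /S /= has_map; apply/hasP => -[] //.
    by rewrite Ew /= negb_or => /andP[].
  + apply: (@matches_rev (behead (S ++ A)) [::] (behead (S ++ A)) (special 0) (special 0)).
      exact: lab_own.
    by rewrite /= inordK.
- rewrite /S /special_row cat_cons; rewrite AF /row cat_cons in labA *.
  by apply: matches_rev labA _; rewrite /= inordK.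
Qed.

(** * Decoding a double match into a run *)

Local Notation pad := (special 4).

Lemma nth_prefix i : i < size tm_prefix ->
  nth pad tm_prefix i = special (if i is j.+1 then block j else 0).
Proof.
rewrite /tm_prefix /= !size_cat !size_nseq /= => lt; case: i lt => [//|i] lt /=.
rewrite !nth_cat !size_nseq !nth_nseq /block.
repeat case: ifP => ?; try lia; try by [].
by have -> : i - n1 - n2 - n3 = 0 by lia.
Qed.

Lemma size_prefix : size tm_prefix = (n1 + n2 + n3).+2.
Proof. by rewrite /tm_prefix /= !size_cat !size_nseq /=; lia. Qed.

Lemma specialK j : j < 5 -> (@inord 4 j : nat) = j.
Proof. by move=> ?; rewrite inordK. Qed.

Lemma branch_nth (w : seq tm_letter) : branch (B := tm) tm_prefix w ->
  (forall i, size tm_prefix <= i.+1 < size w ->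
     tm_next (nth pad (rev w) i) (nth pad (rev w) i.+1)) /\
  (forall i, i < size w -> i < size tm_prefix -> nth pad (rev w) i = nth pad tm_prefix i).
Proof.
elim=> [u x v E|b b' {}w _ [IH1 IH2] nb].
  have sz : size tm_prefix = (size u + size v).+1 by rewrite E size_cat /= addnS.
  rewrite rev_cons revK [size (x :: _)]/= size_rev; split=> [i|i iu _].
    by rewrite sz !ltnS => /andP[a b]; rewrite ltnNge (leq_trans (leq_addr _ _) a) in b.
  by rewrite E -cat_rcons nth_cat size_rcons iu.
rewrite rev_cons; set W := rev (b :: w) in IH1 IH2 *.
have sW : size W = (size w).+1 by rewrite size_rev.
have Wb : nth pad W (size w) = b by rewrite /W rev_cons nth_rcons size_rev ltnn eqxx.
split=> i.
  rewrite [size (b' :: _)]/= => /andP[pi]; rewrite ltnS leq_eqVlt => /orP[/eqP[ei]|lt].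
    by rewrite !nth_rcons sW ei ltnSn ltnn eqxx Wb.
  by rewrite !nth_rcons sW lt (ltn_trans _ lt) //; apply: IH1; rewrite pi.
rewrite [size (b' :: _)]/= ltnS leq_eqVlt => /orP[/eqP->|lt] ip.
  (* Before its last letter the prefix consists of special letters below 4, which have no
     children. *)
  have {}ip : (size w).+1 < size tm_prefix by [].
  exfalso; move: nb; rewrite -Wb (IH2 _ (ltnSn _) (ltnW ip)) nth_prefix ?(ltnW ip) //.
  rewrite size_prefix in ip.
  have nb4 : (if size w is j.+1 then block j else 0) < 4.
    by case: (size w) ip => // j; rewrite /block; repeat (case: ifP => ? //); lia.
  move: nb4; set n := (if _ is _.+1 then _ else _) => nb4.
  by case: b' => [j|[[k t] x]]; rewrite /= specialK; lia.
rewrite nth_rcons sW lt; exact: IH2.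
Qed.

Lemma matches_nth (ls w : seq tm_letter) : matches (B := tm) ls w ->
  [/\ 0 < size ls <= size w,
      forall i, i < size ls -> tm_lab (nth pad w i) (nth pad ls i)
    & tm_start (nth pad w (size ls).-1)].
Proof.
elim: ls w => [//|l ls IH] [//|b w] /= /andP[bl].
case: ls IH => [_ sb|l' ls IH /IH[/andP[_ sz] H S]].
  by split=> // -[].
by split=> // -[|i] // ii; apply: H.
Qed.

Definition is_header b : bool :=
  match b with inl j => j == 0 :> nat | inr (_, _, x) => x == None end.

Definition kind b : nat :=
  match b with inl j => 4 | inr (k, _, _) => k end.

Lemma kind_lt b : kind b < 5.
Proof. by case: b => [//|[[k t] x]] /=; apply: ltn_trans (ltn_ord k) _. Qed.

Lemma compat_kind b b' : compat b b' ->
  is_header b = is_header b' /\ kind b' = next_kind (kind b).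
Proof.
case: b => [j|[[k [[q q']|]] x]]; case: b' => [j'|[[k' t'] x']] //=.
  by case: x' => [[p c]|] /andP[/eqP->]; [case/andP=> /negbTE->|move->].
by case: x => [[p c]|]; case: x' => [[p' c']|] /andP[/eqP->].
Qed.

Lemma next_kindP b b' : tm_next b b' ->
  kind b' = if is_header b' then next_kind (kind b) else kind b.
Proof.
case: b => [j|[[k t] x]]; case: b' => [j'|[[k' t'] x']] //=.
- by case/andP=> _ /eqP->.
- by case/and4P=> _ /eqP-> ->.
- by case: t => [[? ?]|]; case: x => [[? ?]|].
- case: x' => [[p c]|] /=; last by case: t => [[? ?]|] //; case: x => [[? ?]|] // /and3P[/eqP->].
  by case: t => [[? ?]|]; case: x => [[? ?]|] /= /and3P[/eqP->].
Qed.

Lemma next_kind_neq k : k < 5 -> next_kind k != k /\ next_kind (next_kind k) != k.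
Proof. by move: k => [|[|[|[|[|k]]]]]. Qed.

(** Each of the two letters is [l] or may stand below [l]. No kind is its own successor or the
    successor of its successor, so if the kind of [b'] follows that of [b], then [b] is [l] and
    stands above [b']. *)
Lemma shared_label b b' l : tm_lab b l -> tm_lab b' l ->
  is_header b = is_header b' /\ (kind b' = next_kind (kind b) -> compat b b').
Proof.
rewrite /tm_lab => /orP[/eqP->|lb] /orP[/eqP E|lb'].
- by rewrite E; split=> // e; have [] := next_kind_neq (kind_lt b'); rewrite -e eqxx.
- by have [] := compat_kind lb'.
- rewrite -E in lb *; have [H e] := compat_kind lb; split=> // e'.
  by have [_] := next_kind_neq (kind_lt l); rewrite -e -e' eqxx.
- have [H e] := compat_kind lb; have [H' e'] := compat_kind lb'.
  split; first by rewrite -H.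
  have [nk _] := next_kind_neq (kind_lt b).
  by rewrite e' -e => /esym/eqP; rewrite (negbTE nk).
Qed.

Section Decode.
(** [W] is the branch read forwards, [M] the position of its first final letter, [n0] the length of
    its final part, and [x0] the position where the earlier of the two matches starts. *)
Variables (W : seq tm_letter) (M n0 x0 : nat).
Local Notation "w .[ i ]" := (nth pad w i).
Hypothesis W_size : size W = M + n0.
Hypothesis n0_gt0 : 0 < n0.
Hypothesis W_next : forall i, size tm_prefix <= i.+1 < size W -> tm_next W.[i] W.[i.+1].
Hypothesis W_prefix : forall i, i < size W -> i < size tm_prefix ->
  W.[i] = special (if i is j.+1 then block j else 0).
Hypothesis W_fin : forall i, i < size W -> tm_fin W.[i] = (M <= i).
Hypothesis x0M : x0 < M.
Hypothesis W_shift : forall i, x0 <= i < M -> exists l, tm_lab W.[i] l /\ tm_lab W.[i + n0] l.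
Hypothesis W_start0 : tm_start W.[x0].
Hypothesis W_start1 : tm_start W.[x0 + n0].

Local Notation m := (n1 + n2 + n3).+1.

(** A header of kind 0 can only follow padding, and padding outside the prefix only follows padding;
    this leads back to the last letter of the prefix, at position [m]. *)
Lemma pads_below i y : y < size W -> m <= i < y -> kind W.[y] = 0 -> is_header W.[y] ->
  W.[i] = special 4.
Proof.
move=> yW.
suff H d : forall i y', y' <= y -> y' - i <= d -> m <= i < y' -> 
    (kind W.[y'] = 0 /\ is_header W.[y']) \/ W.[y'] = special 4 -> W.[i] = special 4.
  by move=> iy k h; apply: (H (y - i) i y) => //; left.
elim: d => [|d IH] i' y' y'y di iy' Hy; first lia.
have e : y'.-1.+1 = y' by lia.
have : tm_next W.[y'.-1] W.[y'].
  by rewrite -{2}e; apply: W_next; rewrite size_prefix; lia.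
have P : W.[y'] = special 4 \/ (kind W.[y'] = 0 /\ is_header W.[y']) by tauto.
have {P}p4 : tm_next W.[y'.-1] W.[y'] -> W.[y'.-1] = special 4.
  case: P => [->|]; case: W.[y'.-1] => [j|[[k t] x]] /=.
  - by case/andP=> /eqP j4 _; congr inl; apply: val_inj; rewrite /= specialK.
  - by case: t => [[? ?]|]; case: x => [[? ?]|].
  - case: W.[y'] => [j'|[[k' t'] x']] /= [] // _ _ /and4P[/eqP j4 _ _ _].
    by congr inl; apply: val_inj; rewrite /= specialK.
  - case: W.[y'] => [j'|[[k' t'] x']] /= [] // k0 /eqP->.
    case: t => [[? ?]|]; case: x => [[? ?]|] // /and3P[/eqP e' _ _].
    have := ltn_ord k; move/eqP: e'; rewrite k0 /next_kind.
    by case: (k =P 4 :> nat) => [->//|_]; case: (k =P 3 :> nat).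
move/p4 => p.
case: (leqP y'.-1 i') => le; first by have -> : i' = y'.-1 by lia.
by apply: (IH i' y'.-1); rewrite ?p; try lia; right.
Qed.

Lemma no_start i : 0 < i < size W -> tm_start W.[i] -> kind W.[i] = 0 /\ is_header W.[i] /\ m < i.
Proof.
move=> /andP[i0 iW].
case: (leqP (size tm_prefix) i) => pi; last first.
  rewrite W_prefix //; case: i i0 {iW pi} => // i _ /=.
  by have /andP[b0 b5] := block_lt i; rewrite specialK // -leqn0 leqNgt b0.
have := W_next (i := i.-1); rewrite prednK // pi iW => /(_ isT).
rewrite size_prefix in pi.
case: W.[i] => [j|[[k t] x]] /= nx.
  by move=> /eqP j0; case: W.[i.-1] nx => [j'|[[k' [[? ?]|]] [[? ?]|]]]; rewrite /= ?j0 ?andbF.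
by case/andP=> /eqP-> /eqP->.
Qed.

(** Otherwise both matches start at headers of kind 0, although everything from the end of the
    prefix up to the later one is padding. *)
Lemma x0_eq0 : x0 = 0.
Proof.
case: (posnP x0) => // x00; exfalso.
have xW : x0 + n0 < size W by rewrite W_size; lia.
have [|k1 [h1 m1]] := no_start (i := x0) _ W_start0; first by lia.
have [|k2 [h2 m2]] := no_start (i := x0 + n0) _ W_start1; first by lia.
have := pads_below (i := x0) xW _ k2 h2.
by move=> E; move: k1; rewrite E //; lia.
Qed.

Lemma W0 : W.[0] = special 0.
Proof. by rewrite W_prefix ?size_prefix // W_size; lia. Qed.

Lemma Wn0 : [/\ kind W.[n0] = 0, is_header W.[n0] & m < n0].
Proof.
have [||k [h mi]] := no_start (i := n0) _ _.
- by rewrite W_size; have := x0M; lia.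
- by move: W_start1; rewrite x0_eq0.
- by [].
Qed.

Lemma W_row1 i : i.+1 < n0 -> W.[i.+1] = special (block i).
Proof.
move=> i0; have [k h mn] := Wn0.
have n0W : n0 < size W by rewrite W_size; have := x0M; lia.
case: (ltnP i.+1 (size tm_prefix)) => ip; first by rewrite W_prefix // (ltn_trans i0).
rewrite (pads_below (i := i.+1) n0W _ k h) ?i0 ?andbT; last by rewrite size_prefix in ip; lia.
by rewrite size_prefix in ip; congr special; rewrite /block; repeat case: ifP; lia.
Qed.

Lemma W_kind i : i.+1 < size W ->
  kind W.[i.+1] = if is_header W.[i.+1] then next_kind (kind W.[i]) else kind W.[i].
Proof.
move=> iW; case: (ltnP i.+1 (size tm_prefix)) => ip; last by apply/next_kindP/W_next; rewrite ip.
rewrite W_prefix // (W_prefix (ltnW iW) (ltnW ip)).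
by have /andP[b0 b5] := block_lt i; rewrite /= specialK // -leqn0 leqNgt b0.
Qed.

(** Kinds change at headers only, and letters with a common label agree on being headers; so the
    kind at [i + n0] stays one step ahead of that at [i], which fixes the direction of
    compatibility. *)
Lemma W_compat i : i < M -> compat W.[i] W.[i + n0].
Proof.
have sh j : j < M -> exists l, tm_lab W.[j] l /\ tm_lab W.[j + n0] l.
  by move=> jM; apply: W_shift; rewrite x0_eq0.
elim: i => [|i IH] iM.
  have [l [l1 l2]] := sh _ iM; have [_ ->//] := shared_label l1 l2.
  by rewrite add0n W0; have [-> _ _] := Wn0.
have {}IH := IH (ltnW iM).
have [l [l1 l2]] := sh _ iM; have [H C] := shared_label l1 l2; apply: C.
have [_ e] := compat_kind IH.
rewrite W_kind ?W_size; last lia.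
rewrite addSn in H *.
rewrite (W_kind (i := i + n0)) ?W_size; last lia.
by rewrite H e; case: ifP.
Qed.

Lemma W_header i : i < size W -> is_header W.[i] = (n0 %| i).
Proof.
elim/ltn_ind: i => i IH iW; case: (ltnP i n0) => i0.
  case: i i0 {IH iW} => [|i] i0; first by rewrite W0 /= specialK // dvdn0.
  rewrite W_row1 //= gtnNdvd //.
  by have /andP[b0 b5] := block_lt i; rewrite specialK // -leqn0 leqNgt b0.
have iM : i - n0 < M by rewrite W_size in iW; lia.
have [H _] := compat_kind (W_compat iM).
rewrite subnK // in H; rewrite -H IH; try lia.
by rewrite -{2}(subnK i0) dvdn_addl.
Qed.

Definition cell_bits b : bits := if b is inr (_, _, Some (_, c)) then c else full_bits.

(** After a decrement, column [i] is read off from column [i.+1] of the old row; this leaves the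
    last column undetermined, and it has to be known to be empty. *)
Lemma step_bits o (s : store) (c : nat -> bits) n : op_bounded K o ->
  (forall r : 'I_K, s r <= n) ->
  (forall i r, i <= n -> op_bits o r (prev_bits s i r) (col_bits s i r)
                           ((if i is j.+1 then c j else full_bits) r) (c i r)) ->
  exists2 s', op_step o s s' & c n = empty_bits -> forall i, i <= n -> c i = col_bits s' i.
Proof.
move=> bo sn H; case: o bo H => [|j|j|j] /= jK H.
- exists s => // _ i i_n; apply/ffunP => r; exact/eqP/H.
- exists (upd s j (s j).+1) => // _ i i_n; apply/ffunP => r.
  have /eqP-> := H i r i_n; rewrite col_bitsE prev_bitsE col_bitsE /upd.
  by case: (@eqP _ (r : nat) j) => [->|//]; case: i {i_n}.
- have s0 : 0 < s j.
    have := H 0 (Ordinal jK) isT.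
    by rewrite eqxx /full_bits ffunE col_bitsE /= => /eqP<-.
  exists (upd s j (s j).-1) => // cn i i_n; apply/ffunP => r.
  rewrite col_bitsE /upd; case: (@eqP _ (r : nat) j) => rj; last first.
    by have := H i r i_n; case: (@eqP _ (r : nat) j) => // _ /eqP->; rewrite col_bitsE.
  move: i_n; rewrite leq_eqVlt => /orP[/eqP->|i_n].
    by rewrite cn /empty_bits ffunE; have := sn r; rewrite rj; lia.
  have := H i.+1 r i_n; rewrite rj eqxx => /eqP->.
  by rewrite col_bitsE rj; lia.
- exists s; first split=> //.
    have := H 0 (Ordinal jK) isT.
    by rewrite eqxx col_bitsE /= => /andP[_]; rewrite -eqn0Ngt => /eqP.
  by move=> _ i i_n; apply/ffunP => r; have /andP[/eqP-> _] := H i r i_n.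
Qed.

Lemma W_cells y k t i : n0 <= y -> n0 %| y -> W.[y] = inr (k, t, None) ->
  i.+1 < n0 -> y + i.+1 < size W ->
  W.[y + i.+1] = inr (k, t, Some (if i is j.+1 then cell_bits W.[y + j.+1] else full_bits,
                                  cell_bits W.[y + i.+1])).
Proof.
move=> yn dy Wy; have [_ _ mn] := Wn0.
elim: i => [|i IH] i0 iW.
  have h : ~~ is_header W.[y + 1] by rewrite W_header // dvdn_addr // gtnNdvd.
  have := W_next (i := y); rewrite -addn1 iW andbT size_prefix Wy => /(_ _).
  move=> /(_ ltac:(lia)).
  case: W.[y + 1] h => [j|[[k' t'] [[p c]|]]] //= _; case: (t) => [[? ?]|] //=;
    by case/and3P=> /eqP-> /eqP-> /eqP->.
have h : ~~ is_header W.[y + i.+2] by rewrite W_header // dvdn_addr // gtnNdvd.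
have iW' : y + i.+1 < size W by move: iW; rewrite addnS; apply: ltnW.
have {}IH := IH (ltnW i0) iW'.
have := W_next (i := y + i.+1); rewrite -addnS iW andbT size_prefix => /(_ ltac:(lia)).
rewrite [in X in tm_next X _]IH.
case: W.[y + i.+2] h => [j|[[k' t'] [[p c]|]]] //= _; case: (t) => [[? ?]|] //=;
  by case/and3P=> /eqP-> /eqP-> /eqP->.
Qed.

Lemma W_nonfinal_row y k q q1 : n0 <= y < size W -> n0 %| y ->
  W.[y] = inr (k, Some (q, q1), None) ->
  [/\ forall i, i < n0 -> y + i < M, cell_bits W.[y + n0.-1] = empty_bits
    & exists k' t', W.[y + n0] = inr (k', t', None) /\ starts t' q1].
Proof.
move=> /andP[yn yW] dy Wy; have [_ _ mn] := Wn0.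
have yM : y < M by rewrite ltnNge -W_fin // Wy.
have row i : i < n0 -> y + i < M.
  elim: i => [|i IH] i0; first by rewrite addn0.
  have iW : y + i.+1 < size W by have := IH (ltnW i0); rewrite W_size addnS; lia.
  by rewrite ltnNge -W_fin // (W_cells yn dy Wy i0 iW).
have y'W : y + n0 < size W by rewrite W_size ltn_add2r.
have h : is_header W.[y + n0] by rewrite W_header // dvdn_addr.
have c := W_compat yM; rewrite Wy in c.
have [k' [t' Wy']] : exists k' t', W.[y + n0] = inr (k', t', None).
  by case: W.[y + n0] h c => [//|[[k' t'] [?|]] //] _ _; exists k', t'.
have n02 : n0.-2.+1 < n0 by lia.
have en0 : n0.-2.+1 = n0.-1 by lia.
have iW : y + n0.-2.+1 < size W by rewrite W_size en0; have := row n0.-1; lia.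
have := W_cells yn dy Wy n02 iW; rewrite en0 => E.
have := W_next (i := y + n0.-1); rewrite -addnS prednK // y'W andbT size_prefix => /(_ ltac:(lia)).
rewrite E Wy' /= => /and3P[_ /eqP ce st].
by split=> //; exists k', t'.
Qed.

(** Contents are tracked for rows with a transition only: the last row is never left, so its end
    need not be empty and [step_bits] does not determine it. There the state [qf] suffices. *)
Lemma decode_run d y q s k t : size W - y <= d -> n0 <= y < size W -> n0 %| y ->
  W.[y] = inr (k, t, None) -> starts t q -> run T qi tm_store q s ->
  (t <> None -> forall i, i.+1 < n0 -> cell_bits W.[y + i.+1] = col_bits s i) ->
  exists s', run T qi tm_store qf s'.
Proof.
elim: d y q s k t => [|d IH] y q s k t yd yW dy Wy; first by lia.
case: t Wy => [[q0 q1]|] Wy; last by move=> /eqP<- R _; exists s.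
move=> /eqP e R H; 
have {H}Hb : forall i, i.+1 < n0 -> cell_bits W.[y + i.+1] = col_bits s i by apply: H.
subst q0; have [_ _ mn] := Wn0.
have [row Ce [k' [t' [Wy' st]]]] := W_nonfinal_row yW dy Wy.
have yn : n0 <= y by case/andP: yW.
have yn' : n0 <= y + n0 by exact: leq_addl.
have dy' : n0 %| y + n0 by rewrite dvdn_addr.
have yM : y < M by have := row 0 n0_gt0; rewrite addn0.
have y'W : n0 <= y + n0 < size W by rewrite yn' W_size ltn_add2r.
have colP i : i.+1 < n0 -> exists2 o, T q q1 = Some o & forall r,
    op_bits o r (prev_bits s i r) (col_bits s i r)
      ((if i is j.+1 then cell_bits W.[y + n0 + j.+1] else full_bits) r)
      (cell_bits W.[y + n0 + i.+1] r).
  move=> i0; have iM := row _ i0.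
  have iW : y + i.+1 < size W by rewrite W_size; lia.
  have iW' : y + n0 + i.+1 < size W by rewrite W_size; lia.
  have := W_compat iM; rewrite addnAC (W_cells yn' dy' Wy' i0 iW') (W_cells yn dy Wy i0 iW) /=.
  case/andP=> _; case: (T q q1) => // o /forallP H; exists o => // r.
  have := H r; rewrite Hb //; case: (i) i0 => // j j0; by rewrite Hb // ltnW.
have [o To _] := colP 0 ltac:(lia).
have en0 : n0.-2.+1 = n0.-1 by lia.
have n02 : n0.-2.+1 < n0 by lia.
have sn (r : 'I_K) : s r <= n0.-2.
  by move: Ce; rewrite -en0 Hb // => /ffunP/(_ r); rewrite col_bitsE /empty_bits ffunE; lia.
have [|s1 so Hs1] := step_bits (c := fun i => cell_bits W.[y + n0 + i.+1]) (T_bounded To) sn.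
  move=> i r i_n; have [|o' To' H] := colP i; first lia.
  by rewrite To in To'; case: To' => ->; exact: H.
apply: (IH (y + n0) q1 s1 k' t') => //.
- lia.
- by apply: run_trans R (run_step To so (run_refl _ _ _)).
case: t' Wy' st => [[q2 q3]|//] Wy' _ _ i i0; apply: Hs1; last lia.
by have [_ + _] := W_nonfinal_row y'W dy' Wy'; rewrite en0.
Qed.

Lemma decode : exists s', run T qi tm_store qf s'.
Proof.
have [k0 h mn] := Wn0; have n0W : n0 < size W by rewrite W_size; have := x0M; lia.
have [k [t Wy]] : exists k t, W.[n0] = inr (k, t, None).
  by case: W.[n0] k0 h => [//|[[k t] [?|]] //] _ _; exists k, t.
have st : starts t qi.
  have := W_next (i := n0.-1); rewrite prednK // n0W andbT size_prefix => /(_ mn).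
  have -> : n0.-1 = n0.-2.+1 by lia.
  by rewrite W_row1 ?Wy /=; [case/and3P|lia].
apply: (@decode_run (size W) n0 qi tm_store k t) => //; rewrite ?leqnn ?leq_subr //.
  exact: run_refl.
move=> t0 i i0.
have nM : n0 < M by rewrite ltnNge -W_fin // Wy; case: (t) t0.
have iW : n0 + i.+1 < size W by rewrite W_size; lia.
have iM : i.+1 < M by lia.
have := W_compat iM; rewrite addnC (W_cells (leqnn _) (dvdnn _) Wy i0 iW) W_row1 //.
rewrite /special /= => /and3P[_ _ /forallP H]; apply/ffunP => r.
have /andP[b0 b5] := block_lt i.
by rewrite (eqP (H r)) specialK // block_bits col_bitsE.
Qed.

End Decode.

Local Notation "w .[ i ]" := (nth pad w i).

Lemma double_match_decode (ls w t w' : seq tm_letter) (b : tm_letter) :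
  branch (B := tm) tm_prefix w -> w = t ++ b :: w' -> t != [::] -> all tm_fin t -> ~~ tm_fin b ->
  matches (B := tm) ls (b :: w') -> matches (B := tm) ls w ->
  exists s', run T qi tm_store qf s'.
Proof.
move=> bw Ew t0 ft fb M' M.
have [/andP[l0 lw] L S] := matches_nth M.
have [/andP[_ lw'] L' S'] := matches_nth M'.
have [N P] := branch_nth bw.
have sw : size w = size (b :: w') + size t by rewrite Ew size_cat addnC.
have nth_revw i : i < size w -> nth pad (rev w) i = nth pad w (size w - i.+1).
  by move=> ?; rewrite nth_rev.
have nth_w' i : nth pad w (size t + i) = nth pad (b :: w') i.
  by rewrite Ew nth_cat ltnNge leq_addr addKn.
have tpos : 0 < size t by case: (t) t0.
have fins i : i < size (rev w) -> tm_fin (rev w).[i] = (size (b :: w') <= i).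
  rewrite size_rev => iw; case: (leqP (size (b :: w')) i) => ib.
    have lt : size w - i.+1 < size t by move: sw ib iw => /=; lia.
    rewrite nth_revw // [in X in nth _ X]Ew nth_cat lt.
    by move/all_nthP: ft => /(_ pad); apply.
  (* Final letters have only final children and the prefix has none, so a final letter before [b]
     would make [b] final; induction on the distance to [b]. *)
  apply/negbTE.
  elim/ltn_ind: {i}(size (b :: w') - i) {-2}i (erefl (size (b :: w') - i)) ib iw => n IH i ni ib iw.
  case: (ltnP i (size w')) => iw'; last first.
    have ei : i = size w' by apply/eqP; rewrite eqn_leq iw' andbT -ltnS; exact: ib.
    rewrite nth_revw //; have -> : size w - i.+1 = size t + 0 by rewrite sw ei /= addnC addnK addn0.
    by rewrite nth_w'.
  apply/negP => fi.
  have pi : size tm_prefix <= i.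
    rewrite leqNgt; apply/negP => ip; move: fi.
    by rewrite P // nth_prefix.
  have lt1 : size (b :: w') - i.+1 < n by rewrite -ni subnS ltn_predL subn_gt0.
  have iw2 : i.+1 < size w by apply: leq_ltn_trans iw' _; rewrite sw; exact: leq_addr.
  have /negP := IH _ lt1 i.+1 erefl iw' iw2; case.
  have := N i; rewrite iw2 andbT leqW // => /(_ isT).
  case: (rev w).[i] fi => [//|[[k [?|]] x]] //= _.
  case: (rev w).[i.+1] => [//|[[k' t'] [[p c]|]]] //=.
  by case/and3P=> _ /eqP->.
apply: (@decode (rev w) (size (b :: w')) (size t) (size (b :: w') - size ls)) => //.
- by rewrite size_rev.
- by move=> i; rewrite size_rev; apply: N.
- by move=> i iw ip; rewrite P ?nth_prefix // -size_rev.
- lia.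
- move=> i /andP[xi iM]; set j := size (b :: w') - i.+1.
  have jl : j < size ls by rewrite /j; lia.
  exists (nth pad ls j); split.
    rewrite nth_revw; last lia.
    have -> : size w - i.+1 = size t + j by rewrite /j; lia.
    by rewrite nth_w'; apply: L'.
  rewrite nth_revw; last lia.
  have -> : size w - (i + size t).+1 = j by rewrite /j; lia.
  exact: L.
- rewrite nth_revw; last lia.
  have -> : size w - (size (b :: w') - size ls).+1 = size t + (size ls).-1 by lia.
  by rewrite nth_w'.
- rewrite nth_revw; last lia.
  by have -> : size w - (size (b :: w') - size ls + size t).+1 = (size ls).-1 by lia.
Qed.

Lemma double_match_run : double_match (B := tm) tm_prefix ->
  exists s', run T qi tm_store qf s'.
Proof.
by case=> ls [w [bw [t [b [w' [Ew t0 ft fb M']]]] M]];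
  exact: double_match_decode bw Ew t0 ft fb M' M.
Qed.

End Rows.

(** * The diagonal argument *)

Lemma graph_functional n (f : recfun n) v r r' : graph f v r -> graph f v r' -> r = r'.
Proof.
elim: f v r r' => {n} [n||n i|k n f IHf g IHg|n f IHf g IHg|n f IHf] v r r' /=.
- by move=> -> ->.
- by move=> -> ->.
- by move=> -> ->.
- case=> w gw fw [w' gw' fw']; have E : w = w'.
    by apply: eq_from_tnth => i; apply: IHg (gw i) (gw' i).
  by rewrite E in fw; apply: IHf fw fw'.
- case=> s [s0 sS ->] [s' [s0' sS' ->]].
  suff H i : i <= thead v -> s i = s' i by apply: H.
  elim: i => [|i IH] iv; first exact: IHf s0 s0'.
  have := sS' i iv; rewrite -IH ?(ltnW iv) // => H; exact: IHg (sS i iv) H.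
- move=> [r0 rS] [r0' rS']; case: (ltngtP r r') => // lt.
  + by have [k fk] := rS' _ lt; have := IHf _ _ _ r0 fk.
  + by have [k fk] := rS _ lt; have := IHf _ _ _ r0' fk.
Qed.

(** * Computability of the encodings *)

Definition computable n (F : n.-tuple nat -> nat) : Type :=
  {f : recfun n | forall v, graph f v (F v)}.

Lemma computable_eq n (F G : n.-tuple nat -> nat) : F =1 G -> computable F -> computable G.
Proof. by move=> E [f Hf]; exists f => v; rewrite -E. Qed.

Lemma computable_proj n (i : 'I_n) : computable (fun v => tnth v i).
Proof. by exists (RProj i). Qed.

(** As [computable] is informative, the codes of a family can be collected into the function that
    [RComp] expects. *)
Lemma computable_comp k n (F : k.-tuple nat -> nat) (G : 'I_k -> n.-tuple nat -> nat) :
  computable F -> (forall i, computable (G i)) ->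
  computable (fun v => F [tuple G i v | i < k]).
Proof.
move=> [f Hf] HG; exists (RComp f (fun i => sval (HG i))) => v.
exists [tuple G i v | i < k]; last exact: Hf.
by move=> i; rewrite tnth_mktuple; exact: (svalP (HG i)).
Qed.

Lemma computable_comp1 n (F : nat -> nat) (A : n.-tuple nat -> nat) :
  computable (fun v : 1.-tuple nat => F (thead v)) -> computable A ->
  computable (fun v => F (A v)).
Proof.
move=> HF HA; apply: (computable_eq _ (computable_comp HF (fun _ => HA))) => v.
by rewrite /thead tnth_mktuple.
Qed.

Lemma computable_succ n (A : n.-tuple nat -> nat) :
  computable A -> computable (fun v => (A v).+1).
Proof. by apply: (computable_comp1 (F := S)); exists RSucc. Qed.

Lemma computable_const n c : computable (fun _ : n.-tuple nat => c).
Proof. by elim: c => [|c IH]; [exists (RZero n)|exact: computable_succ IH]. Qed.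

Lemma computable_iter n (F : nat -> nat) (A X : n.-tuple nat -> nat) :
  computable (fun v : 1.-tuple nat => F (thead v)) -> computable A -> computable X ->
  computable (fun v => iter (A v) F (X v)).
Proof.
move=> [f Hf] HA HX.
have HI : computable (fun v : 2.-tuple nat => iter (tnth v ord0) F (tnth v (lift ord0 ord0))).
  exists (RPrim (RProj ord0) (RComp f (fun _ => RProj (lift ord0 ord0)))) => v /=.
  exists (fun i => iter i F (tnth v (lift ord0 ord0))); split=> //.
    by rewrite !(tnth_nth 0) nth_behead.
  move=> i _; exists [tuple iter i F (tnth v (lift ord0 ord0)) | _ < 1].
    by move=> j; rewrite tnth_mktuple.
  by have := Hf [tuple iter i F (tnth v (lift ord0 ord0)) | _ < 1]; rewrite /thead tnth_mktuple.
apply: (computable_eq _ (computable_comp (G := fun i => if i == ord0 then A else X) HI _)).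
  by move=> v; rewrite !tnth_mktuple.
by move=> i; case: eqP.
Qed.

Lemma computable_double n (A : n.-tuple nat -> nat) :
  computable A -> computable (fun v => (A v).*2).
Proof.
move=> HA; have C0 := computable_const n 0.
have HS : computable (fun v : 1.-tuple nat => (thead v).+2).
  by do 2!apply: computable_succ; exact: computable_proj.
apply: (computable_eq _ (computable_iter (F := fun x => x.+2) HS HA C0)) => v.
by elim: (A v) => //= a ->.
Qed.

Lemma computable_pred n (A : n.-tuple nat -> nat) :
  computable A -> computable (fun v => (A v).-1).
Proof.
apply: (computable_comp1 (F := predn)).
exists (RPrim (RZero 0) (RProj ord0)) => v /=.
by exists predn; split.
Qed.

Lemma computable_sub n (A B : n.-tuple nat -> nat) :
  computable A -> computable B -> computable (fun v => A v - B v).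
Proof.
move=> HA HB; have HP : computable (fun v : 1.-tuple nat => (thead v).-1).
  by apply: computable_pred; exact: computable_proj.
apply: (computable_eq _ (computable_iter (F := predn) HP HB HA)) => v.
by elim: (B v) => [|b IH] /=; rewrite ?subn0 // IH subnS.
Qed.

(* [code (a :: s)] is [2 ^ a * (2 * code s + 1)]. *)
Definition code_cons (a s : nat) : nat := iter a double s.*2.+1.

Lemma code_consE a s : code (a :: s) = code_cons a (code s).
Proof.
rewrite [LHS]/= -/(CodeSeq.code s) -/(code s) /code_cons; elim: a => [|a IH]; first by rewrite mul1n.
by rewrite /= -IH expnS -mulnA mul2n.
Qed.

Lemma computable_cons n (A S : n.-tuple nat -> nat) :
  computable A -> computable S -> computable (fun v => code_cons (A v) (S v)).
Proof.
move=> HA HS; apply: computable_iter => //.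
  by apply: computable_double; exact: computable_proj.
by apply: computable_succ; exact: computable_double.
Qed.

Definition prefix_step (e d : nat) : nat := code [:: 4; rR; code [:: 3; e; d]].

Lemma computable_prefix_step n e (A : n.-tuple nat -> nat) :
  computable A -> computable (fun v => prefix_step e (A v)).
Proof.
move=> HA; apply: (@computable_eq _ (fun v => code_cons 4 (code_cons rR
    (code_cons (code_cons 3 (code_cons e (code_cons (A v) 0))) 0)))).
  by move=> v; rewrite /prefix_step !code_consE.
by do !apply: computable_cons => //; exact: computable_const.
Qed.

Definition prefix_names (a b c : nat) : seq nat :=
  0 :: nseq a 1 ++ nseq b 2 ++ nseq c 3 ++ [:: 4].

Definition prefix_code (a b c : nat) : nat :=
  encode_concept (prefix_concept (prefix_names a b c)).

Lemma encode_prefix_nseq n k s : encode_concept (prefix_concept (nseq k n ++ s)) =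
  iter k (prefix_step (encode_concept (hid (rLet n)))) (encode_concept (prefix_concept s)).
Proof. by elim: k => [//|k IH]; rewrite [LHS]/= -/(prefix_concept _) IH. Qed.

Lemma computable_prefix n (A B C : n.-tuple nat -> nat) :
  computable A -> computable B -> computable C ->
  computable (fun v => prefix_code (A v) (B v) (C v)).
Proof.
move=> HA HB HC; pose e k := encode_concept (hid (rLet k)).
apply: (@computable_eq _ (fun v => prefix_step (e 0) (iter (A v) (prefix_step (e 1))
  (iter (B v) (prefix_step (e 2)) (iter (C v) (prefix_step (e 3))
  (encode_concept (prefix_concept [:: 4]))))))).
  by move=> v; rewrite /prefix_code /prefix_names -!encode_prefix_nseq.
have HS k : computable (fun v : 1.-tuple nat => prefix_step (e k) (thead v)).
  by apply: computable_prefix_step; exact: computable_proj.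
apply: computable_prefix_step.
by do 3!apply: computable_iter => //; exact: computable_const.
Qed.

(** One decrement followed by a zero test succeeds exactly on the value 1. *)
Lemma exec_accept (g : recfun 3) (s : store) : (forall i, 2 < i -> s i = 0) ->
  (exists s', exec (Seq (compile g [tuple val i | i < 3] 3 4)
                        (Seq (Prim (Dec 3)) (Prim (IfZero 3)))) s s')
  <-> graph g [tuple s i | i < 3] 1.
Proof.
move=> s0; have Em : map_tuple s [tuple val i | i < 3] = [tuple s i | i < 3].
  by apply: eq_from_tnth => i; rewrite tnth_map !tnth_mktuple.
have C s' : exec (compile g [tuple val i | i < 3] 3 4) s s' <->
    exists2 r, graph g [tuple s i | i < 3] r & s' = upd s 3 r.
  rewrite -Em; apply: compile_correct => //.
  - by move=> x /mapP[i _ ->]; rewrite (ltn_trans (ltn_ord i)).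
  - by apply/negP => /mapP[i _ E]; case: i E => i /= i3 E; rewrite -E in i3.
  - exact: s0.
  - by move=> i i4; apply: s0; apply: ltnW.
split=> [[s' [s1 /C[r gr ->] [s2 [/= r0 ->] [z _]]]]|g1].
  have e : r = 1 by move: r0 z; rewrite /upd eqxx; case: r {gr} => [|[|r]].
  by rewrite e in gr.
exists (upd (upd s 3 1) 3 0); exists (upd s 3 1); first by apply/C; exists 1.
by exists (upd (upd s 3 1) 3 0) => //=; rewrite /upd eqxx.
Qed.

(** The branching depends on [g] alone and the input enters through the prefix only, which is what
    makes self-reference possible. *)
Lemma simulate (g : recfun 3) :
  exists (B : branching) (pfx : nat -> nat -> nat -> seq (letter B)),
  forall a b c, map (@name B) (pfx a b c) = prefix_names a b c /\
    (double_match (pfx a b c) <-> graph g [tuple nth 0 [:: a; a + b; a + b + c] i | i < 3] 1).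
Proof.
pose p := Seq (compile g [tuple val i | i < 3] 3 4) (Seq (Prim (Dec 3)) (Prim (IfZero 3))).
have [K bK] := trans_bounded p.
exists (tm (@trans p) (initial p) (final p) K), (tm_prefix (state p) K).
move=> a b c; split.
  by rewrite /tm_prefix /= !map_cat !map_nseq /= !inordK.
have s0 i : 2 < i -> tm_store a b c i = 0 by case: i => [|[|[|i]]] //; rewrite /tm_store /= nth_nil.
rewrite -[X in _ <-> X](exec_accept g s0); split.
  by case/(double_match_run bK) => s' R; exists s'; apply/exec_run.
by case=> s' /exec_run; exact: run_double_match.
Qed.

Definition tbox_code B := code (map encode_inclusion (branch_tbox B)).
Definition abox_code B := code (map encode_assertion (gadget B)).

(** [H] rebuilds the code of an instance from the codes of the gadget, the branching TBox, the
    signature and the prefix concept. The first three are given to the machine as block lengths, and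
    they determine the fourth. *)
Lemma diagonal (X : Type) (encode : X -> nat) (valid P : X -> Prop)
    (inst : forall B : branching, seq (letter B) -> X)
    (sig : branching -> nat) (H : nat -> nat -> nat -> nat -> nat) :
  (forall B pfx, valid (inst B pfx)) ->
  (forall B pfx, P (inst B pfx) <-> ~ double_match pfx) ->
  (forall B pfx, encode (inst B pfx) = H (abox_code B) (tbox_code B) (sig B)
     (encode_concept (prefix_concept (map (@name B) pfx)))) ->
  (forall n (A T S D : n.-tuple nat -> nat),
     computable A -> computable T -> computable S -> computable D ->
     computable (fun v => H (A v) (T v) (S v) (D v))) ->
  undecidable_problem encode valid P.
Proof.
move=> Hv HP He HC [f Hf].
(* The machine starts with partial sums, so the block lengths are recovered as differences. *)
pose A (v : 3.-tuple nat) := tnth v ord0.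
pose T (v : 3.-tuple nat) := tnth v (lift ord0 ord0) - tnth v ord0.
pose S (v : 3.-tuple nat) := tnth v ord_max - tnth v (lift ord0 ord0).
have ATS a b c (v := [tuple nth 0 [:: a; a + b; a + b + c] i | i < 3]) :
    [/\ A v = a, T v = b & S v = c].
  by rewrite /A /T /S !tnth_mktuple /= !addKn.
have CA : computable A by exact: computable_proj.
have CT : computable T by apply: computable_sub; exact: computable_proj.
have CS : computable S by apply: computable_sub; exact: computable_proj.
have [h Hh] := HC _ _ _ _ _ CA CT CS (computable_prefix CA CT CS).
have [B [pfx Hp]] := simulate (RComp f (fun _ : 'I_1 => h)).
(* [B] was obtained before its input is chosen, so the input can consist of codes derived from [B]
   itself. *)
have {Hp}[En Dm] := Hp (abox_code B) (tbox_code B) (sig B).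
set x := inst B (pfx (abox_code B) (tbox_code B) (sig B)).
have [b Gb Hb] := Hf x (Hv _ _).
have E : graph (RComp f (fun _ : 'I_1 => h)) [tuple nth 0
    [:: abox_code B; abox_code B + tbox_code B; abox_code B + tbox_code B + sig B] i | i < 3] 1
    <-> graph f [tuple encode x] 1.
  have [Av Tv Sv] := ATS (abox_code B) (tbox_code B) (sig B).
  set v := mktuple _ in Av Tv Sv *.
  have Ev : encode x = H (A v) (T v) (S v) (prefix_code (A v) (T v) (S v)).
    by rewrite /x He En Av Tv Sv.
  split=> /=.
    case=> w /(_ ord0) hw fw; have -> // : [tuple encode x] = w.
    apply: eq_from_tnth => i; rewrite ord1 Ev; exact: graph_functional (Hh v) hw.
  by move=> fx; exists [tuple encode x] => // i; rewrite ord1 Ev; exact: Hh.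
have {Hb}Hb : b <-> ~ graph f [tuple encode x] 1.
  by rewrite -E -Dm -HP.
case: b Gb Hb => /= Gb [H1 H2]; first exact: H1.
have [|//] := classic (graph f [tuple encode x] 1); last by move/H2.
by move/(graph_functional Gb).
Qed.

Definition gadget_sig (B : branching) : finite_sig :=
  (aStart :: aEnd :: [seq aLab (name b) | b <- enum (letter B)], [:: rR]).

Lemma entails_no_double_match B (pfx : seq (letter B)) S Q : 
  sig_role S rR -> sig_concept S aStart -> sig_concept S aEnd ->
  (forall b : letter B, sig_concept S (aLab (name b))) ->
  sig_entails S Q (kb_small B) (kb_big pfx) <-> ~ double_match pfx.
Proof.
move=> SR SS SE SL; split=> [H D|]; last exact: no_double_match_entails.
exact: double_match_not_entails SR SS SE SL D H.
Qed.

Lemma inseparable_entails B (pfx : seq (letter B)) S Q :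
  sig_inseparable S Q (kb_small B) (kb_big pfx) <-> sig_entails S Q (kb_small B) (kb_big pfx).
Proof. by split=> [[]|H] //; split=> //; exact: big_entails_small. Qed.

Lemma gadget_sigP B : [/\ sig_role (sig_of (gadget_sig B)) rR,
  sig_concept (sig_of (gadget_sig B)) aStart, sig_concept (sig_of (gadget_sig B)) aEnd &
  forall b : letter B, sig_concept (sig_of (gadget_sig B)) (aLab (name b))].
Proof.
split=> // b; have H : aLab (name b) \in [seq aLab (name c) | c <- enum (letter B)].
  by apply/mapP; exists b; rewrite ?mem_enum.
by rewrite /= !in_cons H !orbT.
Qed.

Definition pair_of B (pfx : seq (letter B)) := KBPair (kb_small B) (kb_big pfx).

Lemma pair_valid B (pfx : seq (letter B)) : horn_alc_pair (pair_of pfx).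
Proof. by split; [exact: small_horn|exact: small_consistent|exact: big_consistent]. Qed.

Definition big_code (a t d : nat) : nat :=
  code [:: code_cons (code [:: code [:: 0; aA]; d]) t; a].

Lemma encode_big B (pfx : seq (letter B)) : encode_kb (kb_big pfx) =
  big_code (abox_code B) (tbox_code B) (encode_concept (prefix_concept (map (@name B) pfx))).
Proof.
have E : code (map encode_inclusion (kb_tbox (kb_big pfx))) = _ := code_consE _ _.
by rewrite /encode_kb E.
Qed.

Lemma computable_code2 n (A C : n.-tuple nat -> nat) :
  computable A -> computable C -> computable (fun v => code [:: A v; C v]).
Proof.
move=> HA HC; apply: (@computable_eq _ (fun v => code_cons (A v) (code_cons (C v) 0))).
  by move=> v; rewrite !code_consE.
by do 2!apply: computable_cons => //; exact: computable_const.
Qed.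

Lemma computable_big n (A T D : n.-tuple nat -> nat) : computable A -> computable T ->
  computable D -> computable (fun v => big_code (A v) (T v) (D v)).
Proof.
move=> HA HT HD; apply: computable_code2 => //; apply: computable_cons => //.
by apply: computable_code2 => //; exact: computable_const.
Qed.

Lemma undecidable_sig (P : kb_pair * finite_sig -> Prop) :
  (forall B (pfx : seq (letter B)), P (pair_of pfx, gadget_sig B) <-> ~ double_match pfx) ->
  undecidable_problem encode_kb_pair_sig (fun x => horn_alc_pair x.1) P.
Proof.
(* The 0 in [code [:: 0; a]] is the code of the empty TBox of [kb_small]. *)
move=> HP; apply: (diagonal (inst := fun B pfx => (pair_of pfx, gadget_sig B))
  (sig := fun B => encode_sig (gadget_sig B))
  (H := fun a t s d => code_cons (code [:: 0; a]) (code [:: big_code a t d; s]))) => //.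
- by move=> B pfx; exact: pair_valid.
- by move=> B pfx; rewrite /encode_kb_pair_sig [kb2 _]/= encode_big code_consE.
- move=> n A T S D HA HT HS HD; apply: computable_cons.
    by apply: computable_code2 => //; exact: computable_const.
  by apply: computable_code2 => //; exact: computable_big.
Qed.

Lemma undecidable_pair (P : kb_pair -> Prop) :
  (forall B (pfx : seq (letter B)), P (pair_of pfx) <-> ~ double_match pfx) ->
  undecidable_problem encode_kb_pair horn_alc_pair P.
Proof.
move=> HP; apply: (diagonal (inst := fun B pfx => pair_of pfx) (sig := fun B => 0)
  (H := fun a t s d => code [:: code [:: 0; a]; big_code a t d])) => //.
- by move=> B pfx; exact: pair_valid.
- by move=> B pfx; rewrite /encode_kb_pair [kb2 _]/= encode_big.
- move=> n A T S D HA HT HS HD; apply: computable_code2; last exact: computable_big.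
  by apply: computable_code2 => //; exact: computable_const.
Qed.

Theorem theorem3 :
  (forall Q : query_class,
     undecidable_problem encode_kb_pair_sig
       (fun x : kb_pair * finite_sig => horn_alc_pair x.1)
       (fun x : kb_pair * finite_sig =>
          sig_entails (sig_of x.2) Q (kb1 x.1) (kb2 x.1)))
  /\
  (forall Q : query_class,
     undecidable_problem encode_kb_pair_sig
       (fun x : kb_pair * finite_sig => horn_alc_pair x.1)
       (fun x : kb_pair * finite_sig =>
          sig_inseparable (sig_of x.2) Q (kb1 x.1) (kb2 x.1)))
  /\
  (forall Q : query_class,
     undecidable_problem encode_kb_pair horn_alc_pair
       (fun p : kb_pair => sig_entails full_sig Q (kb1 p) (kb2 p))
     /\
     undecidable_problem encode_kb_pair horn_alc_pair
       (fun p : kb_pair => sig_inseparable full_sig Q (kb1 p) (kb2 p))).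
Proof.
split=> [Q|]; last split=> Q; last split.
- by apply: undecidable_sig => B pfx; have [? ? ? ?] := gadget_sigP B; exact: entails_no_double_match.
- apply: undecidable_sig => B pfx; have [? ? ? ?] := gadget_sigP B.
  by rewrite inseparable_entails; exact: entails_no_double_match.
- by apply: undecidable_pair => B pfx; exact: entails_no_double_match.
- by apply: undecidable_pair => B pfx; rewrite inseparable_entails; exact: entails_no_double_match.
Qed.
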